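(* For every integer $k\ge0$ and every real $0\le y\le1$, $$\sum_{m\in\mathbb{Z}\setminus\{0\}}\frac{\cos(2m\pi y)}{m^{4k+3}}\left(\frac{\cosh\left(2m\pi(y-1/2)\right)}{\sinh(m\pi)}\right)=(2\pi)^{4k+3}\sum_{j=0}^{2k+2}(-1)^{j+1}\frac{B_{2j}(y)}{(2j)!}\frac{B_{4k+4-2j}(y)}{(4k+4-2j)!}.$$ In particular, when $y=0$ and $y=\frac12$ respectively, $$\sum_{m\in\mathbb{Z}\setminus\{0\}}\frac{\coth(m\pi)}{m^{4k+3}}=(2\pi)^{4k+3}\sum_{j=0}^{2k+2}(-1)^{j+1}\frac{B_{2j}(0)}{(2j)!}\frac{B_{4k+4-2j}(0)}{(4k+4-2j)!},$$ $$\sum_{m\in\mathbb{Z}\setminus\{0\}}\frac{(-1)^m}{\sinh(m\pi)m^{4k+3}}=(2\pi)^{4k+3}\sum_{j=0}^{2k+2}(-1)^{j+1}\frac{B_{2j}(1/2)}{(2j)!}\frac{B_{4k+4-2j}(1/2)}{(4k+4-2j)!}.$$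
   Context: $B_j(y)$ is the $j$th Bernoulli polynomial: $\dfrac{te^{ty}}{e^t-1}=\sum_{j=0}^\infty B_j(y)\dfrac{t^j}{j!}$. *)

(* Defs.v *)
From Stdlib Require Import Reals ZArith Arith Lra Lia ClassicalChoice.
From Coquelicot Require Import Coquelicot.

Local Open Scope R_scope.

(** [B j y] is the [j]th Bernoulli polynomial at [y].  The identity is asked
    for on a punctured neighbourhood of [t = 0], where the right-hand side
    would be the junk value [0 / 0]. *)
Definition is_bernoulli (B : nat -> R -> R) : Prop :=
  forall y : R, locally' 0 (fun t : R =>
    is_series (fun j : nat => B j y * (t ^ j / INR (fact j)))
              (t * exp (t * y) / (exp t - 1))).

(** [l] is the sum of the family [f m], [m] ranging over the nonzero integers.
    Convergence is absolute, so the value does not depend on the order of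
    summation. *)
Definition is_sum_nonzero_Z (f : Z -> R) (l : R) : Prop :=
  ex_series (fun n : nat => Rabs (f (Z.of_nat (S n)))) /\
  ex_series (fun n : nat => Rabs (f (- Z.of_nat (S n))%Z)) /\
  l = Series (fun n : nat => f (Z.of_nat (S n))) +
      Series (fun n : nat => f (- Z.of_nat (S n))%Z).

Definition coth (x : R) : R := cosh x / sinh x.

(** Existence of the Bernoulli polynomials: the coefficients [b] of the
    quotient of [e^(ty) = sum c_n t^n] by [(e^t - 1) / t = sum a_n t^n] are
    obtained recursively and grow at most geometrically. *)

Lemma quot_exists (c a : nat -> R) : a O = 1 ->
  exists b : nat -> R, b O = c O /\
    forall n, b (S n) = c (S n) - sum_f_R0 (fun k => b k * a (S n - k)%nat) n.
Proof.
intros Ha.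
set (h := fix h (n : nat) : nat -> R :=
  match n with
  | O => fun _ => c O
  | S p => fun i => if Nat.leb i p then h p i
           else c (S p) - sum_f_R0 (fun k => h p k * a (S p - k)%nat) p
  end).
assert (hS : forall p i, h (S p) i = if Nat.leb i p then h p i
           else c (S p) - sum_f_R0 (fun k => h p k * a (S p - k)%nat) p)
  by reflexivity.
assert (H : forall n i, (i <= n)%nat -> h n i = h i i).
{ induction n as [|n IH]; intros i Hi.
  - now replace i with O by lia.
  - destruct (Nat.eq_dec i (S n)) as [->|Hn]; [reflexivity|].
    rewrite hS. rewrite (proj2 (Nat.leb_le i n)) by lia. apply IH; lia. }
exists (fun n => h n n). split; [reflexivity|]. intros n.
rewrite hS. rewrite (proj2 (Nat.leb_gt (S n) n)) by lia.
f_equal. apply sum_eq. intros i Hi. now rewrite (H n i Hi).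
Qed.

Lemma inv_fact_le (n : nat) : / INR (fact (S n)) <= (/ 2) ^ n.
Proof.
induction n as [|n IH]; [simpl; lra|].
change (fact (S (S n))) with (S (S n) * fact (S n))%nat.
rewrite mult_INR, Rinv_mult. simpl pow.
apply Rmult_le_compat; trivial.
- apply Rlt_le, Rinv_0_lt_compat, lt_0_INR; lia.
- apply Rlt_le, Rinv_0_lt_compat, lt_0_INR, lt_O_fact.
- apply Rinv_le_contravar; [lra|]. rewrite !S_INR. generalize (pos_INR n); lra.
Qed.

Lemma inv_fact_ge0 (n : nat) : 0 <= / INR (fact n).
Proof. apply Rlt_le, Rinv_0_lt_compat, lt_0_INR, lt_O_fact. Qed.

Lemma inv_fact_le1 (n : nat) : / INR (fact n) <= 1.
Proof.
rewrite <- Rinv_1. apply Rinv_le_contravar; [lra|].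
apply (le_INR 1). generalize (lt_O_fact n); lia.
Qed.

Lemma geom_conv_le (C : R) (n : nat) : 2 <= C ->
  sum_f_R0 (fun k => C ^ k * (/ 2) ^ (S n - k)) n <= C ^ S n / 3.
Proof.
intros HC. induction n as [|n IH]; [simpl; lra|].
rewrite tech5.
replace (S (S n) - S n)%nat with 1%nat by lia.
rewrite (sum_eq _ (fun k => C ^ k * (/ 2) ^ (S n - k) * / 2)).
2:{ intros i Hi. replace (S (S n) - i)%nat with (S (S n - i)) by lia.
    simpl; ring. }
rewrite <- scal_sum.
assert (0 < C ^ S n) by (apply pow_lt; lra).
change (C ^ S (S n)) with (C * C ^ S n). nra.
Qed.

Lemma quot_bound (y : R) (b : nat -> R) :
  let c := fun n : nat => y ^ n / INR (fact n) in
  let C := 2 * (1 + Rabs y) in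
  b O = c O ->
  (forall n, b (S n) =
     c (S n) - sum_f_R0 (fun k => b k * / INR (fact (S (S n - k)))) n) ->
  forall n, Rabs (b n) <= C ^ n.
Proof.
intros c C H0 HS.
assert (Hy := Rabs_pos y).
assert (HC : 2 <= C) by (unfold C; lra).
assert (Hc : forall n, Rabs (c (S n)) <= C ^ S n / 2).
{ intros n. unfold c, Rdiv.
  rewrite Rabs_mult, <- RPow_abs, (Rabs_pos_eq (/ _)) by apply inv_fact_ge0.
  assert (H1 : Rabs y ^ S n <= (C / 2) ^ S n).
  { apply pow_incr. unfold C; lra. }
  assert (H2 : (C / 2) ^ S n <= C ^ S n / 2).
  { assert (C ^ n >= (C / 2) ^ n).
    { apply Rle_ge, pow_incr; lra. }
    simpl. nra. }
  assert (H3 := inv_fact_le1 (S n)).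
  assert (H4 := inv_fact_ge0 (S n)).
  assert (H5 : 0 <= Rabs y ^ S n) by now apply pow_le.
  nra. }
intros n. induction n as [n IH] using (well_founded_induction lt_wf).
destruct n as [|n].
- rewrite H0. unfold c. simpl. rewrite Rabs_pos_eq; lra.
- rewrite HS.
  assert (Hs : Rabs (sum_f_R0 (fun k => b k * / INR (fact (S (S n - k)))) n)
               <= C ^ S n / 3).
  { eapply Rle_trans; [apply Rsum_abs|].
    eapply Rle_trans; [|apply geom_conv_le, HC].
    apply sum_Rle. intros k Hk.
    rewrite Rabs_mult, (Rabs_pos_eq (/ _)) by apply inv_fact_ge0.
    apply Rmult_le_compat.
    - apply Rabs_pos.
    - apply inv_fact_ge0.
    - apply IH; lia.
    - apply inv_fact_le. }
  assert (Hn := Hc n).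
  assert (0 < C ^ S n) by (apply pow_lt; lra).
  unfold Rminus. eapply Rle_trans; [apply Rabs_triang|].
  rewrite Rabs_Ropp. lra.
Qed.

Lemma is_bernoulli_at_exists (y : R) :
  exists v : nat -> R, locally' 0 (fun t : R =>
    is_series (fun j : nat => v j * (t ^ j / INR (fact j)))
              (t * exp (t * y) / (exp t - 1))).
Proof.
set (a := fun n : nat => / INR (fact (S n))).
set (c := fun n : nat => y ^ n / INR (fact n)).
destruct (quot_exists c a) as [b [H0 HS]]; [unfold a; simpl; lra|].
assert (Hb := quot_bound y b H0 HS). cbv zeta in Hb.
set (C := 2 * (1 + Rabs y)) in Hb.
assert (HC : 2 <= C) by (unfold C; generalize (Rabs_pos y); lra).
assert (HC' : 0 < / C) by (apply Rinv_0_lt_compat; lra).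
assert (HC1 : / C < 1).
{ rewrite <- Rinv_1. apply Rinv_lt_contravar; lra. }
assert (Rb : Rbar_le (/ C) (CV_radius b)).
{ apply (proj1 (CV_radius_bounded b)). exists 1. intros n.
  rewrite Rabs_mult, <- RPow_abs, (Rabs_pos_eq (/ C)), pow_inv by lra.
  assert (0 < C ^ n) by (apply pow_lt; lra).
  apply (Rmult_le_reg_r (C ^ n)); trivial.
  rewrite Rmult_assoc, Rinv_l by lra. generalize (Hb n); lra. }
assert (Ra : Rbar_le 1 (CV_radius a)).
{ apply (proj1 (CV_radius_bounded a)). exists 1. intros n.
  rewrite pow1, Rmult_1_r. unfold a.
  rewrite Rabs_pos_eq by apply inv_fact_ge0. apply inv_fact_le1. }
assert (Hbac : forall n, PS_mult b a n = c n).
{ intros [|n]; unfold PS_mult.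
  - simpl. rewrite H0. unfold a; simpl. lra.
  - rewrite tech5, Nat.sub_diag, HS. unfold a; simpl fact; simpl INR. lra. }
exists (fun j => b j * INR (fact j)).
exists (mkposreal _ HC'). intros t Ht Ht0.
change (Rabs (t - 0) < / C) in Ht. rewrite Rminus_0_r in Ht.
assert (Tb : Rbar_lt (Rabs t) (CV_radius b)).
{ eapply Rbar_lt_le_trans; [|apply Rb]. exact Ht. }
assert (Ta : Rbar_lt (Rabs t) (CV_radius a)).
{ eapply Rbar_lt_le_trans; [|apply Ra]. simpl. lra. }
assert (Hexp : exp (t * y) = PSeries b t * PSeries a t).
{ rewrite <- PSeries_mult, exp_Reals by trivial.
  unfold PSeries. apply Series_ext. intros n. rewrite Hbac. unfold c.
  rewrite Rpow_mult_distr. unfold Rdiv; ring. }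
assert (Hat : exp t - 1 = t * PSeries a t).
{ rewrite exp_Reals, PSeries_decr_1.
  - simpl. rewrite Rinv_1. unfold a, PS_decr_1. simpl. ring.
  - eexists; apply is_exp_Reals. }
assert (Hne : exp t - 1 <> 0).
{ intros E. apply Ht0. apply exp_inv. rewrite exp_0. lra. }
assert (HP : PSeries a t <> 0).
{ intros E. apply Hne. rewrite Hat, E. ring. }
replace (t * exp (t * y) / (exp t - 1)) with (PSeries b t).
2:{ rewrite Hexp, Hat. field. now split. }
apply (is_series_ext (fun k => scal (pow_n t k) (b k))).
- intros j. rewrite pow_n_pow. change (t ^ j * b j = b j * INR (fact j) *
    (t ^ j / INR (fact j))). field. apply INR_fact_neq_0.
- apply (PSeries_correct b t). now apply CV_radius_inside.
Qed.

Lemma is_bernoulli_exists : exists B : nat -> R -> R, is_bernoulli B.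
Proof.
destruct (choice _ is_bernoulli_at_exists) as [v Hv].
now exists (fun j y => v y j).
Qed.

(* Main.v *)
Require Import Defs.
From Stdlib Require Import Reals ZArith.
From Coquelicot Require Import Coquelicot.
From Stdlib Require Import Lra Lia.
Local Open Scope R_scope.

(** Write [t = 2 pi y] and [c_n = cos (n t)]. The hyperbolic quotient is itself
    a Fourier series (theorem [cos_series_closed_form]): for [x > 0] and
    [0 <= t <= 2 pi],
      [sum_(n >= 1) c_n / (n^2 + x^2)
         = pi / (2 x) cosh (x (t - pi)) / sinh (pi x) - 1 / (2 x^2)].
    Taking [x = m], the left-hand side of the claim becomes a lattice sum with
    terms [c_m c_n / (m^(4k+2) (m^2 + n^2))], plus a multiple of
    [sum c_m / m^(4k+4)]. Averaging the lattice sum with its image under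
    [m <-> n] produces
      [c_m c_n (m^(4k+2) + n^(4k+2)) / ((m n)^(4k+2) (m^2 + n^2))],
    and since [2k+1] is odd, [m^2 + n^2] divides [m^(4k+2) + n^(4k+2)]: the
    lattice sum splits into finitely many products of two sums
    [sum_n c_n / n^(2j)] (lemma [Series_lattice]). Each of these is a multiple
    of [B_(2j)(y)] (theorem [bernoulli_even]), so that the products are the
    terms [0 < j < 2k+2] of the right-hand side, and the extra sum gives its two
    extreme terms.

    Euler's formula for [sum_n c_n / n^(2j)] follows from the same closed form:
    for small [x] the series expands in powers of [x^2] with these sums as
    coefficients, while the right-hand side is, up to elementary factors, the
    even part of the generating function of the Bernoulli polynomials at
    [2 pi x].

    The closed form is obtained without a general theory of Fourier series. The
    partial sums [u_N] satisfy [u_N'' = x^2 u_N - D_N], with [D_N] the Dirichlet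
    sum [sum_(n <= N+1) cos (n t)]; the function
    [c(t) = cosh (x (t - pi))] solves the homogeneous equation, and the
    Wronskian of [u_N] and [c] has derivative [- D_N c]. Away from [t = 0] the
    oscillating part of [D_N] contributes [O(1/N)], so in the limit
    [(u + 1 / (2 x^2)) / c] is constant on [(0, pi]]. Continuity extends this to
    [t = 0], the mean value determines the constant, and the symmetry
    [t -> 2 pi - t] covers the other half of the period. *)

(** * Series and double series *)

Lemma is_lim_seq_partial_sums (a : nat -> R) :
  ex_series a -> is_lim_seq (sum_f_R0 a) (Series a).
Proof.
intros Ha. apply (is_lim_seq_ext (sum_n a)); [intros n; apply sum_n_Reals|].
exact (Series_correct a Ha).
Qed.

Lemma is_lim_seq_unique_finite (w : nat -> R) (l l' : R) :
  is_lim_seq w l -> is_lim_seq w l' -> l = l'.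
Proof.
intros Hl Hl'. apply is_lim_seq_unique in Hl. apply is_lim_seq_unique in Hl'.
rewrite Hl in Hl'. now injection Hl'.
Qed.

Lemma is_series_of_partial_sums (a : nat -> R) (l : R) :
  is_lim_seq (sum_f_R0 a) l -> is_series a l.
Proof.
intros Ha. apply (is_lim_seq_ext _ (sum_n a)) in Ha; [exact Ha|].
intros n; symmetry; apply sum_n_Reals.
Qed.

Lemma ex_series_dominated (a b : nat -> R) :
  (forall n, Rabs (a n) <= b n) -> ex_series b -> ex_series a.
Proof. intros Hab Hb. exact (ex_series_le a b Hab Hb). Qed.

Lemma Series_dominated (a b : nat -> R) :
  (forall n, Rabs (a n) <= b n) -> ex_series b -> Rabs (Series a) <= Series b.
Proof.
intros Hab Hb. eapply Rle_trans.
- apply Series_Rabs. apply (ex_series_dominated _ b); trivial.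
  intros n. now rewrite Rabs_Rabsolu.
- apply Series_le; trivial. intros n. split; [apply Rabs_pos|apply Hab].
Qed.

(** The bound depends on the majorant [b] alone, which makes it uniform over
    families of series such as [cos_series x t] below. *)
Lemma Series_tail_dominated (a b : nat -> R) (N : nat) :
  (forall n, Rabs (a n) <= b n) -> ex_series b ->
  Rabs (Series a - sum_f_R0 a N) <= Series b - sum_f_R0 b N.
Proof.
intros Hab Hb.
rewrite (Series_incr_n a (S N)), (Series_incr_n b (S N));
  [|lia|exact Hb|lia|exact (ex_series_dominated a b Hab Hb)].
rewrite !Nat.pred_succ.
replace (_ + _ - sum_f_R0 a N) with (Series (fun k => a (S N + k)%nat)) by ring.
replace (_ + _ - sum_f_R0 b N) with (Series (fun k => b (S N + k)%nat)) by ring.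
apply Series_dominated; [intros n; apply Hab|].
now apply (ex_series_incr_n b (S N)).
Qed.

Definition inv_sq (n : nat) : R := / INR (S n) ^ 2.

Lemma INR_S_pos (n : nat) : 0 < INR (S n).
Proof. apply lt_0_INR; lia. Qed.

Lemma INR_S_ge1 (n : nat) : 1 <= INR (S n).
Proof. apply (le_INR 1); lia. Qed.

Lemma inv_sq_pos (n : nat) : 0 < inv_sq n.
Proof. apply Rinv_0_lt_compat, pow_lt, INR_S_pos. Qed.

Lemma ex_series_inv_sq : ex_series inv_sq.
Proof.
assert (H : ex_finite_lim_seq (sum_f_R0 inv_sq)).
{ apply (ex_finite_lim_seq_incr _ 2).
  - intros n. simpl sum_f_R0. generalize (inv_sq_pos (S n)); lra.
  - intros n. apply Rle_trans with (2 - / INR (S n)).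
    (* telescoping: [1 / (r + 1)^2 <= 1 / r - 1 / (r + 1)] *)
    + induction n as [|n IH]; [unfold inv_sq; simpl; lra|].
      rewrite tech5. change (inv_sq (S n)) with (/ INR (S (S n)) ^ 2).
      assert (Hn := INR_S_pos n). rewrite (S_INR (S n)).
      set (r := INR (S n)) in *.
      assert (/ (r + 1) ^ 2 <= / r - / (r + 1)); [|lra].
      apply Rminus_le_0.
      replace (_ - _) with (/ (r * (r + 1) ^ 2)) by (field; lra).
      apply Rlt_le, Rinv_0_lt_compat. apply Rmult_lt_0_compat; [lra|].
      apply pow_lt; lra.
    + generalize (Rinv_0_lt_compat _ (INR_S_pos n)); lra. }
destruct H as [l Hl]. exists l. now apply is_series_of_partial_sums.
Qed.

(** Both discrepancies between an iterated sum and a square partial sum, the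
    missing columns and the missing rows, are at most the total of [u] times
    a tail of [u]. *)
Lemma is_lim_seq_square_sums (g : nat -> nat -> R) (u : nat -> R) :
  (forall m n, Rabs (g m n) <= u m * u n) -> (forall n, 0 <= u n) ->
  ex_series u ->
  is_lim_seq (fun N => sum_f_R0 (fun m => sum_f_R0 (g m) N) N)
    (Series (fun m => Series (g m))).
Proof.
intros Hg Hu0 Hu.
set (G := fun m => Series (g m)). set (U := Series u).
assert (HuS : forall m, ex_series (fun n => u m * u n))
  by (intros m; now apply (ex_series_scal (V := R_NormedModule) (u m) u)).
assert (Hus : ex_series (fun m => u m * U)) by now apply (ex_series_scal_r U u).
assert (HG : forall m, Rabs (G m) <= u m * U).
{ intros m. unfold U. rewrite <- Series_scal_l.
  apply Series_dominated; trivial. }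
set (tail := fun N => U - sum_f_R0 u N).
assert (Ht : is_lim_seq tail 0).
{ replace (Finite 0) with (Finite (U - U)) by (f_equal; ring).
  apply is_lim_seq_minus'; [apply is_lim_seq_const|].
  now apply is_lim_seq_partial_sums. }
assert (Hsum : forall N, 0 <= sum_f_R0 u N <= U).
{ intros N. split; [now apply cond_pos_sum|].
  apply Rminus_le_0. eapply Rle_trans; [apply Rabs_pos|].
  apply (Series_tail_dominated u u); trivial.
  intros n. rewrite Rabs_pos_eq; [apply Rle_refl|apply Hu0]. }
apply (is_lim_seq_le_le (fun N => Series G - 2 * U * tail N) _
                        (fun N => Series G + 2 * U * tail N)).
- intros N.
  assert (H1 : Rabs (Series G - sum_f_R0 G N) <= U * tail N).
  { eapply Rle_trans; [apply (Series_tail_dominated G _ N HG Hus)|].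
    rewrite Series_scal_r, <- scal_sum. unfold tail. fold U. lra. }
  assert (H2 : Rabs (sum_f_R0 G N - sum_f_R0 (fun m => sum_f_R0 (g m) N) N)
               <= U * tail N).
  { rewrite <- minus_sum. eapply Rle_trans; [apply Rsum_abs|].
    apply Rle_trans with (sum_f_R0 (fun m => u m * tail N) N).
    - apply sum_Rle. intros m _. unfold tail, U.
      eapply Rle_trans;
        [apply (Series_tail_dominated (g m) (fun n => u m * u n)); trivial|].
      rewrite Series_scal_l. rewrite (sum_eq _ (fun n => u n * u m));
        [|intros; ring].
      rewrite <- scal_sum. lra.
    - rewrite <- scal_sum. rewrite Rmult_comm.
      apply Rmult_le_compat_r; [|apply Hsum]. unfold tail.
      generalize (Hsum N); lra. }
  apply Rabs_le_between in H1. apply Rabs_le_between in H2. lra.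
- replace (Finite (Series G)) with (Finite (Series G - 2 * U * 0))
    by (f_equal; ring).
  apply is_lim_seq_minus'; [apply is_lim_seq_const|].
  apply (is_lim_seq_mult' (fun _ => 2 * U)); [apply is_lim_seq_const|exact Ht].
- replace (Finite (Series G)) with (Finite (Series G + 2 * U * 0))
    by (f_equal; ring).
  apply is_lim_seq_plus'; [apply is_lim_seq_const|].
  apply (is_lim_seq_mult' (fun _ => 2 * U)); [apply is_lim_seq_const|exact Ht].
Qed.

Lemma sum_f_R0_exchange (g : nat -> nat -> R) (M N : nat) :
  sum_f_R0 (fun m => sum_f_R0 (g m) N) M =
  sum_f_R0 (fun n => sum_f_R0 (fun m => g m n) M) N.
Proof.
induction M as [|M IH]; [reflexivity|].
rewrite tech5, IH, <- plus_sum. apply sum_eq. intros n _. now rewrite tech5.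
Qed.

Lemma sum_f_R0_prod (a b : nat -> R) (M N : nat) :
  sum_f_R0 (fun m => sum_f_R0 (fun n => a m * b n) N) M =
  sum_f_R0 a M * sum_f_R0 b N.
Proof.
transitivity (sum_f_R0 (fun m => a m * sum_f_R0 b N) M).
- apply sum_eq. intros m _. rewrite scal_sum. apply sum_eq. intros n _. ring.
- rewrite <- scal_sum. ring.
Qed.

(** * Hyperbolic functions and derivatives *)

Lemma is_derive_cosh (x : R) : is_derive cosh x (sinh x).
Proof. apply is_derive_Reals, derivable_pt_lim_cosh. Qed.

Lemma is_derive_sinh (x : R) : is_derive sinh x (cosh x).
Proof. apply is_derive_Reals, derivable_pt_lim_sinh. Qed.

Lemma cosh_opp (x : R) : cosh (- x) = cosh x.
Proof. unfold cosh. rewrite Ropp_involutive. lra. Qed.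

Lemma sinh_opp (x : R) : sinh (- x) = - sinh x.
Proof. unfold sinh. rewrite Ropp_involutive. lra. Qed.

Lemma exp_mul_exp_opp (x : R) : exp x * exp (- x) = 1.
Proof. rewrite <- exp_plus, Rplus_opp_r. apply exp_0. Qed.

Lemma cosh_ge1 (x : R) : 1 <= cosh x.
Proof.
unfold cosh. assert (H := exp_pos x). assert (H' := exp_pos (- x)).
assert (E := exp_mul_exp_opp x).
assert (0 <= exp (- x) * (exp x - 1) ^ 2).
{ apply Rmult_le_pos; [lra|apply pow2_ge_0]. }
nra.
Qed.

Lemma Rabs_sinh_le_cosh (x : R) : Rabs (sinh x) <= cosh x.
Proof.
apply Rabs_le. unfold sinh, cosh.
generalize (exp_pos x) (exp_pos (- x)); lra.
Qed.

Lemma cosh_le (x y : R) : Rabs x <= y -> cosh x <= cosh y.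
Proof.
intros H.
assert (Hx : cosh x = cosh (Rabs x)).
{ unfold Rabs. destruct (Rcase_abs x); [now rewrite cosh_opp|reflexivity]. }
rewrite Hx. assert (H0 := Rabs_pos x). set (z := Rabs x) in *. clearbody z.
unfold cosh.
assert (E : exp y - exp z = exp y * exp z * (exp (- z) - exp (- y))).
{ transitivity (exp y * (exp z * exp (- z)) - exp z * (exp y * exp (- y)));
    [|ring].
  rewrite !exp_mul_exp_opp. ring. }
assert (H1 : exp (- y) <= exp (- z)).
{ destruct (Req_dec y z) as [->|]; [lra|]. left. apply exp_increasing. lra. }
assert (1 <= exp y * exp z).
{ rewrite <- exp_plus, <- exp_0. destruct (Req_dec (y + z) 0) as [->|]; [lra|].
  left. apply exp_increasing. lra. }
nra.
Qed.

Lemma sinh_pos (x : R) : 0 < x -> 0 < sinh x.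
Proof. intros H. rewrite <- sinh_0. now apply sinh_lt. Qed.

Lemma is_derive_sum_f_R0 (f df : nat -> R -> R) (t : R) (N : nat) :
  (forall n, is_derive (f n) t (df n t)) ->
  is_derive (fun t => sum_f_R0 (fun n => f n t) N) t
            (sum_f_R0 (fun n => df n t) N).
Proof.
intros H. induction N as [|N IH]; [apply H|].
exact (is_derive_plus _ _ _ _ _ IH (H (S N))).
Qed.

Lemma Rabs_increment_le (f df : R -> R) (a b K : R) :
  a <= b -> (forall t, a <= t <= b -> is_derive f t (df t)) ->
  (forall t, a <= t <= b -> Rabs (df t) <= K) ->
  Rabs (f b - f a) <= K * (b - a).
Proof.
intros Hab Hd HK.
destruct (MVT_gen f a b df) as [c [Hc Ec]];
  try (rewrite Rmin_left, Rmax_right in * by lra).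
- intros t Ht. apply Hd; lra.
- intros t Ht. apply derivable_continuous_pt.
  exists (df t). apply is_derive_Reals, Hd, Ht.
- rewrite Ec, Rabs_mult, (Rabs_pos_eq (b - a)) by lra.
  apply Rmult_le_compat_r; [lra|]. now apply HK.
Qed.

(** * The Fourier series of the hyperbolic cosine *)

(** The sum has [N + 1] terms, whence the frequency
    [INR (S N) + / 2 = N + 3/2] in its closed form. *)
Definition dirichlet_sum (N : nat) (t : R) : R :=
  sum_f_R0 (fun n => cos (INR (S n) * t)) N.

Lemma dirichlet_sumE (N : nat) (t : R) :
  2 * sin (t / 2) * dirichlet_sum N t =
  sin ((INR (S N) + / 2) * t) - sin (t / 2).
Proof.
assert (step : forall n : nat, 2 * sin (t / 2) * cos (INR (S n) * t) =
  sin ((INR (S n) + / 2) * t) - sin ((INR n + / 2) * t)).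
{ intros n. rewrite form4.
  replace (((INR (S n) + / 2) * t - (INR n + / 2) * t) / 2) with (t / 2)
    by (rewrite S_INR; field).
  replace (((INR (S n) + / 2) * t + (INR n + / 2) * t) / 2)
    with (INR (S n) * t) by (rewrite S_INR; field).
  ring. }
unfold dirichlet_sum.
induction N as [|N IH].
- change (sum_f_R0 _ 0) with (cos (INR 1 * t)). rewrite step.
  f_equal. f_equal. simpl. field.
- rewrite tech5, Rmult_plus_distr_l, IH, step. ring.
Qed.

Definition centered_cosh (x t : R) : R := cosh (x * (t - PI)).
Definition centered_sinh (x t : R) : R := sinh (x * (t - PI)).

Definition cos_sum (x : R) (N : nat) (t : R) : R :=
  sum_f_R0 (fun n => cos (INR (S n) * t) / (INR (S n) ^ 2 + x ^ 2)) N.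

Definition cos_sum' (x : R) (N : nat) (t : R) : R :=
  sum_f_R0 (fun n => - INR (S n) * sin (INR (S n) * t)
                     / (INR (S n) ^ 2 + x ^ 2)) N.

Lemma denominator_pos (x : R) (n : nat) : 0 < INR (S n) ^ 2 + x ^ 2.
Proof. generalize (pow_lt _ 2 (INR_S_pos n)) (pow2_ge_0 x); lra. Qed.

Lemma is_derive_centered_cosh (x t : R) :
  is_derive (centered_cosh x) t (x * centered_sinh x t).
Proof.
apply (is_derive_comp cosh (fun t => x * (t - PI))).
- apply is_derive_cosh.
- auto_derive; trivial. ring.
Qed.

Lemma is_derive_centered_sinh (x t : R) :
  is_derive (centered_sinh x) t (x * centered_cosh x t).
Proof.
apply (is_derive_comp sinh (fun t => x * (t - PI))).
- apply is_derive_sinh.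
- auto_derive; trivial. ring.
Qed.

Lemma is_derive_cos_sum (x : R) (N : nat) (t : R) :
  is_derive (cos_sum x N) t (cos_sum' x N t).
Proof.
apply (is_derive_sum_f_R0
  (fun n t => cos (INR (S n) * t) / (INR (S n) ^ 2 + x ^ 2))
  (fun n t => - INR (S n) * sin (INR (S n) * t) / (INR (S n) ^ 2 + x ^ 2))).
intros n. assert (H := denominator_pos x n).
set (r := INR (S n)) in *. clearbody r. auto_derive; [lra|]. field. lra.
Qed.

Lemma is_derive_cos_sum' (x : R) (N : nat) (t : R) :
  is_derive (cos_sum' x N) t (x ^ 2 * cos_sum x N t - dirichlet_sum N t).
Proof.
unfold cos_sum, dirichlet_sum. rewrite scal_sum, <- minus_sum.
apply (is_derive_sum_f_R0
  (fun n t => - INR (S n) * sin (INR (S n) * t) / (INR (S n) ^ 2 + x ^ 2))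
  (fun n t => cos (INR (S n) * t) / (INR (S n) ^ 2 + x ^ 2) * x ^ 2
              - cos (INR (S n) * t))).
intros n. assert (H := denominator_pos x n).
set (r := INR (S n)) in *. clearbody r. auto_derive; [lra|]. field. lra.
Qed.

(** The Wronskian of [cos_sum x N] and [centered_cosh x] minus its limit
    [centered_sinh x t / (2 x)]. The last term removes the oscillating part of
    the derivative: the Wronskian's derivative contains the multiple
    [sin ((N + 3/2) t) / (2 sin (t / 2))] of [centered_cosh x], which
    has no factor [1 / N], and that term is what one integration by parts of it produces. *)
Definition wronskian_error (x : R) (N : nat) (t : R) : R :=
  cos_sum' x N t * centered_cosh x t - x * cos_sum x N t * centered_sinh x t
  - centered_sinh x t / (2 * x)
  - cos ((INR (S N) + / 2) * t) * centered_cosh x t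
    / (2 * (INR (S N) + / 2) * sin (t / 2)).

Lemma is_derive_wronskian_error (x : R) (N : nat) (t : R) :
  0 < x -> 0 < t <= PI ->
  is_derive (wronskian_error x N) t
    (- cos ((INR (S N) + / 2) * t) / (2 * (INR (S N) + / 2))
     * ((x * centered_sinh x t * sin (t / 2)
         - centered_cosh x t * cos (t / 2) / 2) / sin (t / 2) ^ 2)).
Proof.
intros Hx Ht. assert (Hs : 0 < sin (t / 2)) by (apply sin_gt_0; lra).
assert (HN := INR_S_pos N).
assert (D := dirichlet_sumE N t).
assert (D' : dirichlet_sum N t =
  (sin ((INR (S N) + / 2) * t) - sin (t / 2)) / (2 * sin (t / 2))).
{ rewrite <- D. field. lra. }
unfold wronskian_error.
assert (E1 := is_derive_cos_sum x N t). assert (E2 := is_derive_cos_sum' x N t).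
assert (E3 := is_derive_centered_cosh x t).
assert (E4 := is_derive_centered_sinh x t).
rewrite D' in E2.
set (u := cos_sum x N) in *. set (u' := cos_sum' x N) in *.
set (c := centered_cosh x) in *. set (s := centered_sinh x) in *.
set (M := INR (S N) + / 2) in *. assert (HM : 0 < M) by (unfold M; lra).
clearbody u u' c s M.
auto_derive.
- repeat split; try (eexists; eassumption).
  apply Rgt_not_eq, Rmult_lt_0_compat; [lra|exact Hs].
- rewrite (is_derive_unique _ _ _ E1 : Derive (fun t => u t) t = _).
  rewrite (is_derive_unique _ _ _ E2 : Derive (fun t => u' t) t = _).
  rewrite (is_derive_unique _ _ _ E3 : Derive (fun t => c t) t = _).
  rewrite (is_derive_unique _ _ _ E4 : Derive (fun t => s t) t = _).
  change (t * / 2) with (t / 2). field. lra.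
Qed.

Lemma sin_INR_PI (n : nat) : sin (INR n * PI) = 0.
Proof. apply sin_eq_0_1. exists (Z.of_nat n). now rewrite <- INR_IZR_INZ. Qed.

Lemma centered_cosh_bounds (x t : R) : 0 < x -> 0 <= t <= PI ->
  1 <= centered_cosh x t <= cosh (x * PI).
Proof.
intros Hx Ht. split; [apply cosh_ge1|]. apply cosh_le.
rewrite Rabs_left1 by nra. nra.
Qed.

Lemma centered_PI (x : R) : centered_cosh x PI = 1 /\ centered_sinh x PI = 0.
Proof.
unfold centered_cosh, centered_sinh.
rewrite Rminus_diag, Rmult_0_r. split; [apply cosh_0|apply sinh_0].
Qed.

Lemma sin_half_ge (a t : R) : 0 < a -> a <= t <= PI ->
  0 < sin (a / 2) <= sin (t / 2).
Proof.
intros Ha Ht. assert (H := PI_RGT_0).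
split; [apply sin_gt_0; lra|apply sin_incr_1; lra].
Qed.

Lemma Rabs_cos_le1 (t : R) : Rabs (cos t) <= 1.
Proof. apply Rabs_le, COS_bound. Qed.

Lemma Rabs_sin_le1 (t : R) : Rabs (sin t) <= 1.
Proof. apply Rabs_le, SIN_bound. Qed.

Lemma half_frequency_inv (N : nat) :
  0 < / (2 * (INR (S N) + / 2)) <= / INR (S N).
Proof.
assert (H := INR_S_pos N). split.
- apply Rinv_0_lt_compat; lra.
- apply Rinv_le_contravar; lra.
Qed.

(** The derivative carries the factor [1 / N], and the value at [pi] is [O(1/N)]
    because every [sin (n pi)] vanishes. *)
Lemma wronskian_error_bound (x a : R) : 0 < x -> 0 < a <= PI ->
  exists K, forall N t, a <= t <= PI ->
    Rabs (wronskian_error x N t) <= K * / INR (S N).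
Proof.
intros Hx Ha.
set (L := (x + 1) * cosh (x * PI) / sin (a / 2) ^ 2).
exists (L * PI + 1). intros N t Ht.
assert (HM := half_frequency_inv N).
assert (HC := cosh_ge1 (x * PI)).
assert (Hsa := sin_half_ge a a (proj1 Ha) (conj (Rle_refl a) (proj2 Ha))).
assert (Hsa2 : 0 < sin (a / 2) ^ 2) by (apply pow_lt; lra).
assert (HL : 0 <= L).
{ apply Rmult_le_pos; [nra|]. apply Rlt_le, Rinv_0_lt_compat; lra. }
assert (H1 : Rabs (wronskian_error x N PI) <= / INR (S N)).
{ unfold wronskian_error. destruct (centered_PI x) as [-> ->].
  replace (cos_sum' x N PI) with 0.
  2:{ symmetry. unfold cos_sum'. rewrite (sum_eq _ (fun _ => 0 * 0)).
      - rewrite <- scal_sum. ring.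
      - intros n _. rewrite sin_INR_PI. unfold Rdiv. ring. }
  rewrite sin_PI2.
  set (M := 2 * (INR (S N) + / 2)) in *.
  replace (_ - _) with (- cos ((INR (S N) + / 2) * PI) * / M).
  2:{ unfold Rdiv. rewrite !Rmult_1_r. ring. }
  rewrite Rabs_mult, Rabs_Ropp, (Rabs_pos_eq (/ M)) by lra.
  assert (H := Rabs_cos_le1 ((INR (S N) + / 2) * PI)). nra. }
assert (H2 : Rabs (wronskian_error x N PI - wronskian_error x N t)
             <= L * / INR (S N) * (PI - t)).
{ eapply Rabs_increment_le; [lra| |].
  - intros r Hr. apply is_derive_wronskian_error; lra.
  - intros r Hr. simpl.
    assert (Hc := centered_cosh_bounds x r Hx ltac:(lra)).
    assert (Hs := Rabs_sinh_le_cosh (x * (r - PI))).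
    fold (centered_cosh x r) (centered_sinh x r) in Hs.
    assert (Hsr := sin_half_ge a r (proj1 Ha) ltac:(lra)).
    set (M := 2 * (INR (S N) + / 2)) in *.
    set (num := x * centered_sinh x r * sin (r / 2)
                - centered_cosh x r * cos (r / 2) / 2).
    assert (Hnum : Rabs num <= (x + 1) * cosh (x * PI)).
    { unfold num, Rminus. eapply Rle_trans; [apply Rabs_triang|].
      unfold Rdiv. rewrite Rabs_Ropp, !Rabs_mult.
      rewrite (Rabs_pos_eq x), (Rabs_pos_eq (/ 2)) by lra.
      rewrite (Rabs_pos_eq (centered_cosh x r)) by lra.
      assert (Q1 := Rabs_cos_le1 (r / 2)). assert (Q2 := Rabs_sin_le1 (r / 2)).
      assert (Q3 := Rabs_pos (cos (r / 2))).
      assert (Q4 := Rabs_pos (sin (r / 2))).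
      assert (Q5 := Rabs_pos (centered_sinh x r)).
      set (C := cosh (x * PI)) in *. set (c := centered_cosh x r) in *.
      set (s := Rabs (centered_sinh x r)) in *.
      assert (s * Rabs (sin (r / 2)) <= C) by nra.
      assert (c * Rabs (cos (r / 2)) <= C) by nra.
      nra. }
    replace (_ * _) with (- cos ((INR (S N) + / 2) * r) * / M *
                          (num * / sin (r / 2) ^ 2)) by reflexivity.
    rewrite !Rabs_mult, Rabs_Ropp.
    assert (Hs2 : 0 < sin (a / 2) ^ 2 <= sin (r / 2) ^ 2).
    { split; trivial. apply pow_incr; lra. }
    assert (Hi : 0 < / sin (r / 2) ^ 2 <= / sin (a / 2) ^ 2).
    { split; [apply Rinv_0_lt_compat; lra|apply Rinv_le_contravar; lra]. }
    rewrite (Rabs_pos_eq (/ M)), (Rabs_pos_eq (/ sin (r / 2) ^ 2)) by lra.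
    unfold L, Rdiv. rewrite (Rmult_comm _ (/ INR (S N))).
    apply Rmult_le_compat.
    + apply Rmult_le_pos; [apply Rabs_pos|lra].
    + apply Rmult_le_pos; [apply Rabs_pos|lra].
    + assert (Q := Rabs_cos_le1 ((INR (S N) + / 2) * r)). nra.
    + apply Rmult_le_compat; try lra. apply Rabs_pos. }
apply Rabs_le_between in H1. apply Rabs_le_between in H2.
assert (HN : 0 < / INR (S N)) by (apply Rinv_0_lt_compat, INR_S_pos).
assert (L * / INR (S N) * (PI - t) <= L * / INR (S N) * PI).
{ apply Rmult_le_compat_l; [nra|lra]. }
apply Rabs_le. nra.
Qed.

Definition cos_series (x t : R) : R :=
  Series (fun n => cos (INR (S n) * t) / (INR (S n) ^ 2 + x ^ 2)).

Lemma cos_term_dominated (x t : R) (n : nat) :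
  Rabs (cos (INR (S n) * t) / (INR (S n) ^ 2 + x ^ 2)) <= inv_sq n.
Proof.
assert (H := pow_lt _ 2 (INR_S_pos n)). assert (Hx := pow2_ge_0 x).
unfold Rdiv. rewrite Rabs_mult, (Rabs_pos_eq (/ _))
  by (apply Rlt_le, Rinv_0_lt_compat; lra).
rewrite <- (Rmult_1_l (inv_sq n)). apply Rmult_le_compat.
- apply Rabs_pos.
- apply Rlt_le, Rinv_0_lt_compat; lra.
- apply Rabs_cos_le1.
- apply Rinv_le_contravar; lra.
Qed.

Lemma is_lim_seq_cos_sum (x t : R) :
  is_lim_seq (fun N => cos_sum x N t) (cos_series x t).
Proof.
apply (is_lim_seq_partial_sums
  (fun n => cos (INR (S n) * t) / (INR (S n) ^ 2 + x ^ 2))).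
apply (ex_series_dominated _ inv_sq); [|apply ex_series_inv_sq].
intros n; apply cos_term_dominated.
Qed.

Lemma is_lim_seq_inv_INR_S : is_lim_seq (fun N => / INR (S N)) 0.
Proof.
apply (is_lim_seq_incr_1 (fun n => / INR n)).
replace (Finite 0) with (Rbar_inv p_infty) by reflexivity.
apply is_lim_seq_inv; [apply is_lim_seq_INR|discriminate].
Qed.

Lemma lim_eq_0_of_bound (w v : nat -> R) (l : R) :
  is_lim_seq w l -> (forall N, Rabs (w N) <= v N) -> is_lim_seq v 0 -> l = 0.
Proof.
intros Hw Hb Hv.
apply (is_lim_seq_unique_finite w); trivial. apply is_lim_seq_abs_0.
apply (is_lim_seq_le_le (fun _ => 0) _ v); trivial.
- intros N. split; [apply Rabs_pos|apply Hb].
- apply is_lim_seq_const.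
Qed.

(** By the Wronskian estimate the derivative of
    [(cos_sum x N + 1 / (2 x^2)) / centered_cosh x] is [O(1/N)] between [t] and
    [pi], so the limit of this quotient takes the same value at both ends. The
    constant in [O(1/N)] blows up as [t] tends to [0]. *)
Lemma cos_series_interior (x t : R) : 0 < x -> 0 < t <= PI ->
  cos_series x t =
  (cos_series x PI + / (2 * x ^ 2)) * centered_cosh x t - / (2 * x ^ 2).
Proof.
intros Hx Ht.
destruct (wronskian_error_bound x t Hx Ht) as [K HK].
set (C := cosh (x * PI)).
set (L := K + C / sin (t / 2)).
set (Rq := fun N r =>
  (cos_sum x N r + / (2 * x ^ 2)) / centered_cosh x r).
assert (Hx2 : 0 < x ^ 2) by now apply pow_lt.
assert (Hder : forall N r, t <= r <= PI -> is_derive (Rq N) r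
  ((wronskian_error x N r
    + cos ((INR (S N) + / 2) * r) * centered_cosh x r
      / (2 * (INR (S N) + / 2) * sin (r / 2))) / centered_cosh x r ^ 2)).
{ intros N r Hr.
  assert (Hc := centered_cosh_bounds x r Hx ltac:(lra)).
  assert (Hs := sin_half_ge t r (proj1 Ht) Hr).
  assert (E1 := is_derive_cos_sum x N r).
  assert (E3 := is_derive_centered_cosh x r).
  unfold Rq, wronskian_error.
  assert (HN := INR_S_pos N).
  set (M := INR (S N) + / 2) in *. assert (HM : 0 < M) by (unfold M; lra).
  set (u := cos_sum x N) in *. set (u' := cos_sum' x N) in *.
  set (c := centered_cosh x) in *. set (s := centered_sinh x) in *.
  clearbody u u' c s M.
  auto_derive.
  - repeat split; try (eexists; eassumption). lra.
  - rewrite (is_derive_unique _ _ _ E1 : Derive (fun t => u t) r = _).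
    rewrite (is_derive_unique _ _ _ E3 : Derive (fun t => c t) r = _).
    field. lra. }
assert (Hinc : forall N, Rabs (Rq N PI - Rq N t) <= L * / INR (S N) * (PI - t)).
{ intros N. apply Rabs_increment_le with (1 := proj2 Ht) (2 := Hder N).
  intros r Hr.
  assert (Hc := centered_cosh_bounds x r Hx ltac:(lra)). fold C in Hc.
  assert (Hs := sin_half_ge t r (proj1 Ht) Hr).
  assert (HM := half_frequency_inv N).
  assert (HN : 0 < / INR (S N)) by (apply Rinv_0_lt_compat, INR_S_pos).
  set (e := cos ((INR (S N) + / 2) * r) * centered_cosh x r
            / (2 * (INR (S N) + / 2) * sin (r / 2))).
  assert (He : Rabs e <= C / sin (t / 2) * / INR (S N)).
  { unfold e, Rdiv.
    rewrite Rinv_mult, !Rabs_mult.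
    assert (Hi : 0 < / sin (r / 2) <= / sin (t / 2)).
    { split; [apply Rinv_0_lt_compat; lra|apply Rinv_le_contravar; lra]. }
    set (M := 2 * (INR (S N) + / 2)) in *.
    rewrite (Rabs_pos_eq (centered_cosh x r)), (Rabs_pos_eq (/ M)),
      (Rabs_pos_eq (/ sin _)) by lra.
    assert (Q := Rabs_cos_le1 ((INR (S N) + / 2) * r)).
    assert (Q' := Rabs_pos (cos ((INR (S N) + / 2) * r))).
    rewrite (Rmult_comm (/ M)), <- Rmult_assoc.
    apply Rmult_le_compat; try lra.
    - apply Rmult_le_pos; [apply Rmult_le_pos|]; lra.
    - apply Rmult_le_compat; try lra.
      + apply Rmult_le_pos; lra.
      + nra. }
  assert (Hw := HK N r Hr).
  assert (Hi : 0 < / centered_cosh x r ^ 2 <= 1).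
  { assert (1 <= centered_cosh x r ^ 2) by (apply pow_R1_Rle; lra).
    split; [apply Rinv_0_lt_compat; lra|].
    rewrite <- Rinv_1. apply Rinv_le_contravar; lra. }
  unfold Rdiv at 1. rewrite Rabs_mult, (Rabs_pos_eq (/ _ ^ 2)) by lra.
  assert (Rabs (wronskian_error x N r + e) <= L * / INR (S N)).
  { eapply Rle_trans; [apply Rabs_triang|]. unfold L. lra. }
  assert (Hp := Rabs_pos (wronskian_error x N r + e)).
  fold e. nra. }
assert (Hc := centered_cosh_bounds x t Hx ltac:(lra)).
assert (Hlim : is_lim_seq (fun N => Rq N PI - Rq N t)
  ((cos_series x PI + / (2 * x ^ 2)) / centered_cosh x PI -
   (cos_series x t + / (2 * x ^ 2)) / centered_cosh x t)).
{ assert (Hq : forall r, is_lim_seq (fun N => Rq N r)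
    ((cos_series x r + / (2 * x ^ 2)) / centered_cosh x r)).
  { intros r. apply (is_lim_seq_scal_r _ (/ centered_cosh x r)
      (Finite (cos_series x r + / (2 * x ^ 2)))).
    apply is_lim_seq_plus'; [apply is_lim_seq_cos_sum|apply is_lim_seq_const]. }
  apply is_lim_seq_minus'; apply Hq. }
assert (H0 := lim_eq_0_of_bound _ _ _ Hlim Hinc).
rewrite (proj1 (centered_PI x)) in H0.
assert (H1 : (cos_series x PI + / (2 * x ^ 2)) / 1 -
   (cos_series x t + / (2 * x ^ 2)) / centered_cosh x t = 0).
{ apply H0. replace (Finite 0) with (Rbar_mult (L * 0) (PI - t))
    by (simpl; f_equal; ring).
  apply is_lim_seq_scal_r.
  apply (is_lim_seq_scal_l _ L (Finite 0)). apply is_lim_seq_inv_INR_S. }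
apply Rminus_diag_uniq in H1.
set (P := cos_series x PI) in *. set (T := cos_series x t) in *.
set (c := centered_cosh x t) in *.
apply (f_equal (fun r => r * c)) in H1.
replace ((T + / (2 * x ^ 2)) / c * c) with (T + / (2 * x ^ 2)) in H1
  by (field; lra).
lra.
Qed.

Lemma cos_tail (x t : R) (N : nat) :
  Rabs (cos_series x t - cos_sum x N t)
  <= Series inv_sq - sum_f_R0 inv_sq N.
Proof.
apply (Series_tail_dominated
  (fun n => cos (INR (S n) * t) / (INR (S n) ^ 2 + x ^ 2)));
  [apply cos_term_dominated|apply ex_series_inv_sq].
Qed.

Lemma is_lim_seq_inv_sq_tail :
  is_lim_seq (fun N => Series inv_sq - sum_f_R0 inv_sq N) 0.
Proof.
replace (Finite 0) with (Finite (Series inv_sq - Series inv_sq))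
  by (f_equal; ring).
apply is_lim_seq_minus'; [apply is_lim_seq_const|].
apply is_lim_seq_partial_sums, ex_series_inv_sq.
Qed.

(** Uniform limit of the partial sums, the tails being bounded by those of
    [inv_sq]. *)
Lemma continuity_cos_series (x t : R) : continuity_pt (cos_series x) t.
Proof.
apply (CVU_continuity (cos_sum x) (cos_series x) t (mkposreal 1 Rlt_0_1)).
- intros eps Heps.
  destruct (proj1 (is_lim_seq_Reals _ _) is_lim_seq_inv_sq_tail eps Heps)
    as [N HN].
  exists N. intros n r Hn _. specialize (HN n Hn).
  unfold Rdist in HN. rewrite Rminus_0_r in HN.
  eapply Rle_lt_trans; [apply cos_tail|].
  eapply Rle_lt_trans; [apply Rle_abs|exact HN].
- intros n r _. apply derivable_continuous_pt.
  exists (cos_sum' x n r). apply is_derive_Reals, is_derive_cos_sum.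
- unfold Boule. simpl. rewrite Rminus_diag, Rabs_R0. lra.
Qed.

Lemma continuity_extend_0 (f g : R -> R) (b : R) : 0 < b ->
  continuity_pt f 0 -> continuity_pt g 0 ->
  (forall t, 0 < t <= b -> f t = g t) -> f 0 = g 0.
Proof.
intros Hb Hf Hg Heq. apply Rminus_diag_uniq.
destruct (Req_dec (f 0 - g 0) 0) as [|Hne]; trivial. exfalso.
destruct (continuity_pt_minus f g 0 Hf Hg (Rabs (f 0 - g 0))
            (Rabs_pos_lt _ Hne)) as [d [Hd Hlim]].
set (t := Rmin (d / 2) b).
assert (Ht : 0 < t) by (apply Rmin_glb_lt; lra).
assert (Ht' := Rmin_l (d / 2) b). assert (Ht'' := Rmin_r (d / 2) b).
fold t in Ht', Ht''.
specialize (Hlim t).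
unfold minus_fct in Hlim. simpl in Hlim. unfold Rdist in Hlim.
rewrite (Heq t) in Hlim by lra.
replace (g t - g t - (f 0 - g 0)) with (- (f 0 - g 0)) in Hlim by ring.
rewrite Rabs_Ropp in Hlim.
apply (Rlt_irrefl (Rabs (f 0 - g 0))). apply Hlim.
split; [split; [exact I|lra]|].
rewrite Rminus_0_r, Rabs_pos_eq; lra.
Qed.

Lemma cos_series_half_period (x t : R) : 0 < x -> 0 <= t <= PI ->
  cos_series x t =
  (cos_series x PI + / (2 * x ^ 2)) * centered_cosh x t - / (2 * x ^ 2).
Proof.
intros Hx [Ht Ht'].
destruct Ht as [Ht|<-]; [apply cos_series_interior; lra|].
apply (continuity_extend_0 (cos_series x) (fun t =>
  (cos_series x PI + / (2 * x ^ 2)) * centered_cosh x t - / (2 * x ^ 2)) PI).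
- apply PI_RGT_0.
- apply continuity_cos_series.
- apply derivable_continuous_pt.
  exists ((cos_series x PI + / (2 * x ^ 2)) * (x * centered_sinh x 0)).
  apply is_derive_Reals.
  assert (E := is_derive_centered_cosh x 0).
  set (c := centered_cosh x) in *. clearbody c.
  auto_derive; [eexists; exact E|].
  rewrite (is_derive_unique _ _ _ E : Derive (fun t => c t) 0 = _).
  simpl; ring.
- intros t H. now apply cos_series_interior.
Qed.

(** The remaining constant is fixed by the mean value of the series over
    [0 <= t <= pi], which is zero: each term has a primitive vanishing at both
    ends. Integrals are avoided by comparing a primitive of the closed form with
    the primitives of the partial sums. *)
Lemma cos_series_PI (x : R) : 0 < x ->
  cos_series x PI + / (2 * x ^ 2) = PI / (2 * x * sinh (x * PI)).
Proof.
intros Hx. set (K := cos_series x PI + / (2 * x ^ 2)).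
assert (Hx2 : 0 < x ^ 2) by now apply pow_lt.
set (prim := fun t => K * centered_sinh x t / x - t / (2 * x ^ 2)).
set (v := fun N t => sum_f_R0 (fun n => sin (INR (S n) * t)
            / (INR (S n) * (INR (S n) ^ 2 + x ^ 2))) N).
assert (Hv : forall N t, is_derive (v N) t (cos_sum x N t)).
{ intros N t. apply (is_derive_sum_f_R0
    (fun n t => sin (INR (S n) * t) / (INR (S n) * (INR (S n) ^ 2 + x ^ 2)))
    (fun n t => cos (INR (S n) * t) / (INR (S n) ^ 2 + x ^ 2))).
  intros n. assert (H := denominator_pos x n). assert (Hn := INR_S_pos n).
  set (r := INR (S n)) in *. clearbody r.
  auto_derive; trivial. field. simpl in *. lra. }
assert (Hp : forall t, 0 <= t <= PI -> is_derive prim t (cos_series x t)).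
{ intros t Ht. rewrite (cos_series_half_period x t Hx Ht). fold K.
  unfold prim.
  assert (E := is_derive_centered_sinh x t).
  set (c := centered_cosh x) in *. set (s := centered_sinh x) in *.
  clearbody c s.
  auto_derive; [eexists; exact E|].
  rewrite (is_derive_unique _ _ _ E : Derive (fun t => s t) t = _).
  field. lra. }
assert (Hinc : forall N, Rabs ((prim PI - v N PI) - (prim 0 - v N 0)) <=
   (Series inv_sq - sum_f_R0 inv_sq N) * (PI - 0)).
{ intros N. apply (Rabs_increment_le (fun t => prim t - v N t)
    (fun t => cos_series x t - cos_sum x N t)).
  - apply Rlt_le, PI_RGT_0.
  - intros t Ht. exact (is_derive_minus _ _ _ _ _ (Hp t Ht) (Hv N t)).
  - intros t _. apply cos_tail. }
assert (H0 : prim PI - prim 0 = 0).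
{ apply (lim_eq_0_of_bound (fun _ => prim PI - prim 0)
    (fun N => (Series inv_sq - sum_f_R0 inv_sq N) * (PI - 0))).
  - apply is_lim_seq_const.
  - intros N. eapply Rle_trans; [|apply Hinc].
    replace (v N PI) with 0; [replace (v N 0) with 0|].
    + right. f_equal. ring.
    + symmetry. unfold v. rewrite (sum_eq _ (fun _ => 0 * 0)).
      * rewrite <- scal_sum. ring.
      * intros n _. rewrite Rmult_0_r, sin_0. unfold Rdiv. ring.
    + symmetry. unfold v. rewrite (sum_eq _ (fun _ => 0 * 0)).
      * rewrite <- scal_sum. ring.
      * intros n _. rewrite sin_INR_PI. unfold Rdiv. ring.
  - replace (Finite 0) with (Rbar_mult 0 (PI - 0))
      by (simpl; f_equal; ring).
    apply is_lim_seq_scal_r. apply is_lim_seq_inv_sq_tail. }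
unfold prim in H0. rewrite (proj2 (centered_PI x)) in H0.
unfold centered_sinh in H0.
replace (x * (0 - PI)) with (- (x * PI)) in H0 by ring.
rewrite sinh_opp in H0.
assert (Hs : 0 < sinh (x * PI)).
{ apply sinh_pos, Rmult_lt_0_compat; [exact Hx|apply PI_RGT_0]. }
set (s := sinh (x * PI)) in *.
assert (E : K * s / x = PI / (2 * x ^ 2)).
{ unfold Rdiv in *. lra. }
apply (f_equal (fun r => r * (x / s))) in E.
replace (K * s / x * (x / s)) with K in E by (field; lra).
rewrite E. field. lra.
Qed.

Lemma cos_series_sym (x t : R) : cos_series x (2 * PI - t) = cos_series x t.
Proof.
unfold cos_series. apply Series_ext. intros n. f_equal.
replace (INR (S n) * (2 * PI - t))
  with (- (INR (S n) * t) + 2 * INR (S n) * PI) by ring.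
now rewrite cos_period, cos_neg.
Qed.

Theorem cos_series_closed_form (x t : R) : 0 < x -> 0 <= t <= 2 * PI ->
  cos_series x t =
  PI / (2 * x) * (cosh (x * (t - PI)) / sinh (x * PI)) - / (2 * x ^ 2).
Proof.
intros Hx Ht.
assert (Hs : 0 < sinh (x * PI)).
{ apply sinh_pos, Rmult_lt_0_compat; [exact Hx|apply PI_RGT_0]. }
assert (Hhalf : forall t, 0 <= t <= PI -> cos_series x t =
  PI / (2 * x) * (cosh (x * (t - PI)) / sinh (x * PI)) - / (2 * x ^ 2)).
{ intros r Hr. rewrite (cos_series_half_period x r Hx Hr), cos_series_PI by lra.
  unfold centered_cosh. field. lra. }
destruct (Rle_dec t PI) as [H|H]; [apply Hhalf; lra|].
rewrite <- cos_series_sym, Hhalf by lra.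
replace (x * (2 * PI - t - PI)) with (- (x * (t - PI))) by ring.
now rewrite cosh_opp.
Qed.

(** * Expansion in powers of the parameter *)

Definition cos_zeta (j : nat) (t : R) : R :=
  Series (fun n => cos (INR (S n) * t) / INR (S n) ^ (2 * j)).

Lemma ex_series_finite_sum (a : nat -> nat -> R) (N : nat) :
  (forall i, ex_series (a i)) ->
  ex_series (fun n => sum_f_R0 (fun i => a i n) N).
Proof.
intros Ha. induction N as [|N IH]; [apply Ha|].
exact (ex_series_plus _ _ IH (Ha (S N))).
Qed.

Lemma Series_finite_sum (a : nat -> nat -> R) (N : nat) :
  (forall i, ex_series (a i)) ->
  Series (fun n => sum_f_R0 (fun i => a i n) N) =
  sum_f_R0 (fun i => Series (a i)) N.
Proof.
intros Ha. induction N as [|N IH]; [reflexivity|].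
rewrite tech5, <- IH, <- Series_plus; trivial.
now apply ex_series_finite_sum.
Qed.

Lemma cos_zeta_term_dominated (j n : nat) (t : R) :
  Rabs (cos (INR (S n) * t) / INR (S n) ^ (2 * S j)) <= inv_sq n.
Proof.
assert (H : 0 < INR (S n) ^ 2) by apply pow_lt, INR_S_pos.
assert (H' : INR (S n) ^ 2 <= INR (S n) ^ (2 * S j))
  by (apply Rle_pow; [apply INR_S_ge1|lia]).
unfold Rdiv. rewrite Rabs_mult, (Rabs_pos_eq (/ _))
  by (apply Rlt_le, Rinv_0_lt_compat; lra).
rewrite <- (Rmult_1_l (inv_sq n)). apply Rmult_le_compat.
- apply Rabs_pos.
- apply Rlt_le, Rinv_0_lt_compat; lra.
- apply Rabs_cos_le1.
- apply Rinv_le_contravar; lra.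
Qed.

Lemma ex_series_cos_zeta (j : nat) (t : R) :
  ex_series (fun n => cos (INR (S n) * t) / INR (S n) ^ (2 * S j)).
Proof.
apply (ex_series_dominated _ inv_sq); [|apply ex_series_inv_sq].
intros n. apply cos_zeta_term_dominated.
Qed.

Lemma geometric_remainder (a b : R) (N : nat) : 0 < a -> 0 <= b ->
  / (a + b) = sum_f_R0 (fun i => (-1) ^ i * b ^ i / a ^ S i) N
              + (-1) ^ S N * b ^ S N / a ^ S N * / (a + b).
Proof.
intros Ha Hb. induction N as [|N IH].
- simpl. field. lra.
- rewrite IH at 1. rewrite tech5, Rplus_assoc. f_equal.
  assert (H : 0 < a ^ N) by now apply pow_lt.
  simpl. revert H. generalize (a ^ N) (b ^ N) ((-1) ^ N). intros p q s H.
  field. lra.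
Qed.

(** Only a finite sum is interchanged with a series: the geometric expansion of
    [1 / (n^2 + x^2)] is stopped at order [N], and the remainders add up to
    [O (x^(2 N + 2))]. *)
Lemma is_series_cos_series (x t : R) : Rabs x < 1 ->
  is_series (fun i => (-1) ^ i * cos_zeta (S i) t * (x ^ 2) ^ i)
            (cos_series x t).
Proof.
intros Hx. apply is_series_of_partial_sums.
assert (Hx0 : 0 <= x ^ 2) by apply pow2_ge_0.
assert (Hx1 : x ^ 2 < 1).
{ rewrite <- Rsqr_pow2. rewrite <- (Rsqr_1). apply Rsqr_lt_abs_1.
  now rewrite Rabs_R1. }
set (p := fun N =>
  sum_f_R0 (fun i => (-1) ^ i * cos_zeta (S i) t * (x ^ 2) ^ i) N).
set (c := fun n => cos (INR (S n) * t)).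
set (a := fun i n => ((-1) ^ i * (x ^ 2) ^ i) * (c n / INR (S n) ^ (2 * S i))).
assert (Ha : forall i, ex_series (a i)).
{ intros i. apply (ex_series_scal (V := R_NormedModule)).
  apply ex_series_cos_zeta. }
assert (Hp : forall N, p N = Series (fun n => sum_f_R0 (fun i => a i n) N)).
{ intros N. rewrite Series_finite_sum by trivial. apply sum_eq. intros i _.
  unfold a. rewrite Series_scal_l.
  change (Series _) with (cos_zeta (S i) t). ring. }
assert (Hs : ex_series (fun n => c n / (INR (S n) ^ 2 + x ^ 2))).
{ apply (ex_series_dominated _ inv_sq); [|apply ex_series_inv_sq].
  intros n. apply cos_term_dominated. }
assert (Hd : forall N, Rabs (p N - cos_series x t)
                       <= Series inv_sq * (x ^ 2) ^ S N).
{ intros N. rewrite Rabs_minus_sym, Hp. unfold cos_series. fold c.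
  rewrite <- Series_minus; [|exact Hs|now apply ex_series_finite_sum].
  rewrite <- Series_scal_r.
  apply Series_dominated; [|apply ex_series_scal_r, ex_series_inv_sq].
  intros n.
  assert (Hr := pow_lt _ 2 (INR_S_pos n)).
  assert (Hr1 : 1 <= INR (S n) ^ 2) by (apply pow_R1_Rle, INR_S_ge1).
  replace (c n / _ - _) with
    (c n / (INR (S n) ^ 2 + x ^ 2) *
     ((-1) ^ S N * (x ^ 2) ^ S N * / (INR (S n) ^ 2) ^ S N)).
  - rewrite !Rabs_mult, pow_1_abs, Rmult_1_l.
    assert (0 <= (x ^ 2) ^ S N) by now apply pow_le.
    assert (H1 : 1 <= (INR (S n) ^ 2) ^ S N) by now apply pow_R1_Rle.
    assert (H2 : 0 < / (INR (S n) ^ 2) ^ S N <= 1).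
    { split; [apply Rinv_0_lt_compat; lra|].
      rewrite <- Rinv_1. apply Rinv_le_contravar; lra. }
    rewrite (Rabs_pos_eq ((x ^ 2) ^ S N)), (Rabs_pos_eq (/ _)) by lra.
    apply Rmult_le_compat.
    + apply Rabs_pos.
    + apply Rmult_le_pos; lra.
    + apply cos_term_dominated.
    + nra.
  - unfold Rdiv at 2.
    rewrite (geometric_remainder (INR (S n) ^ 2) (x ^ 2) N Hr Hx0).
    rewrite Rmult_plus_distr_l.
    rewrite (scal_sum _ _ (c n)).
    rewrite (sum_eq (fun i => a i n) (fun i => (-1) ^ i * (x ^ 2) ^ i
       / (INR (S n) ^ 2) ^ S i * c n)).
    + unfold Rdiv. ring.
    + intros i _. unfold a. rewrite (pow_mult _ 2 (S i)). unfold Rdiv. ring. }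
assert (Hl : is_lim_seq (fun N => p N - cos_series x t) 0).
{ apply is_lim_seq_abs_0.
  apply (is_lim_seq_le_le (fun _ => 0) _
          (fun N => Series inv_sq * (x ^ 2) ^ S N)).
  - intros N. split; [apply Rabs_pos|apply Hd].
  - apply is_lim_seq_const.
  - replace (Finite 0) with (Rbar_mult (Series inv_sq) 0)
      by (simpl; f_equal; ring).
    apply is_lim_seq_scal_l.
    apply (is_lim_seq_incr_1 (fun N => (x ^ 2) ^ N)).
    apply is_lim_seq_geom. rewrite Rabs_pos_eq; lra. }
apply (is_lim_seq_ext (fun N => p N - cos_series x t + cos_series x t)).
- intros N. unfold p. ring.
- replace (Finite (cos_series x t)) with (Finite (0 + cos_series x t))
    by (f_equal; ring).
  apply is_lim_seq_plus'; [exact Hl|apply is_lim_seq_const].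
Qed.

(** * Bernoulli polynomials of even index *)

Lemma CV_radius_pos (a : nat -> R) (r : R) :
  0 < r -> ex_pseries a r -> Rbar_lt 0 (CV_radius a).
Proof.
intros Hr [l Hl]. apply Rbar_not_le_lt. intros H.
apply (CV_disk_outside a r).
- eapply Rbar_le_lt_trans; [exact H|]. simpl. rewrite Rabs_pos_eq; lra.
- apply ex_series_lim_0. exists l. now apply is_pseries_R.
Qed.

(** Multiplying both series by [t] makes them vanish at [t = 0], where nothing
    is assumed, so that they agree on a full neighbourhood; the price is a shift of
    the coefficients. *)
Lemma pseries_unique_punctured (a b : nat -> R) :
  locally' 0 (fun t => exists l, is_pseries a t l /\ is_pseries b t l) ->
  forall n, a n = b n.
Proof.
intros [d Hd] n.
assert (H : forall t, Rabs t < d -> exists l,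
  is_pseries (PS_incr_1 a) t l /\ is_pseries (PS_incr_1 b) t l).
{ intros t Ht. destruct (Req_dec t 0) as [->|Ht0].
  - exists 0. split; apply is_pseries_R, is_series_of_partial_sums;
      apply (is_lim_seq_ext (fun _ => 0)); try apply is_lim_seq_const;
      intros N; (induction N as [|N IH]; [change (0 = 0 * 1); ring|]);
      rewrite tech5, <- IH; simpl; ring.
  - destruct (Hd t) as [l [Ha Hb]]; trivial.
    { change (Rabs (t - 0) < d). now rewrite Rminus_0_r. }
    exists (t * l).
    split; now apply (is_pseries_incr_1 (V := R_NormedModule)). }
assert (Hd2 : 0 < d / 2) by (generalize (cond_pos d); lra).
destruct (H (d / 2)) as [l [Ha Hb]].
{ rewrite Rabs_pos_eq; generalize (cond_pos d); lra. }
apply (PSeries_ext_recip (PS_incr_1 a) (PS_incr_1 b) (S n)).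
- apply (CV_radius_pos _ (d / 2) Hd2). now exists l.
- apply (CV_radius_pos _ (d / 2) Hd2). now exists l.
- exists d. intros t Ht. change (Rabs (t - 0) < d) in Ht.
  rewrite Rminus_0_r in Ht. destruct (H t Ht) as [l' [Ha' Hb']].
  now rewrite (is_pseries_unique _ _ _ Ha'), (is_pseries_unique _ _ _ Hb').
Qed.

(** The even part in [t] of the generating function of the Bernoulli
    polynomials. For [t = 2 pi x] it equals
    [2 x^2 cos_series x (2 pi y) + 1], which links it to the sums
    [cos_zeta j]. *)
Definition even_generating (y t : R) : R :=
  t / 2 * (cosh (t * (y - 1 / 2)) / sinh (t / 2)).

Lemma even_generatingE (y t : R) : t <> 0 ->
  even_generating y t =
  / 2 * (t * exp (t * y) / (exp t - 1)
         + - t * exp (- t * y) / (exp (- t) - 1)).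
Proof.
intros Ht. unfold even_generating, cosh, sinh.
(* everything is rational in [u] and [w] *)
set (u := exp (t / 2)). set (w := exp (t * (y - 1 / 2))).
assert (Hu : 0 < u) by apply exp_pos. assert (Hw : 0 < w) by apply exp_pos.
replace (exp (- (t * (y - 1 / 2)))) with (/ w) by (symmetry; apply exp_Ropp).
replace (exp (- (t / 2))) with (/ u) by (symmetry; apply exp_Ropp).
replace (exp (- t * y)) with (/ (w * u)).
2:{ unfold w, u. rewrite <- exp_plus, <- exp_Ropp. f_equal. field. }
replace (exp (t * y)) with (w * u).
2:{ unfold w, u. rewrite <- exp_plus. f_equal. field. }
replace (exp (- t)) with (/ (u * u)).
2:{ unfold u. rewrite <- exp_plus, <- exp_Ropp. f_equal. field. }
replace (exp t) with (u * u).
2:{ unfold u. rewrite <- exp_plus. f_equal. field. }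
assert (Hu1 : u <> 1).
{ unfold u. intros E. rewrite <- exp_0 in E. apply exp_inv in E. lra. }
assert (u * u - 1 <> 0) by nra.
assert (1 - u * u <> 0) by nra.
field. repeat split; try lra; nra.
Qed.

Definition bernoulli_even_part (B : nat -> R -> R) (y : R) (n : nat) : R :=
  (1 + (-1) ^ n) / 2 * (B n y / INR (fact n)).

Lemma is_pseries_bernoulli_even_part (B : nat -> R -> R) (y : R) :
  is_bernoulli B ->
  locally' 0 (fun t =>
    is_pseries (bernoulli_even_part B y) t (even_generating y t)).
Proof.
intros HB. destruct (HB y) as [d Hd]. exists d. intros t Ht Ht0.
assert (Hp := Hd t Ht Ht0).
assert (Hn : is_series (fun j => B j y * ((- t) ^ j / INR (fact j)))
               (- t * exp (- t * y) / (exp (- t) - 1))).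
{ apply Hd.
  - change (Rabs (t - 0) < d) in Ht. change (Rabs (- t - 0) < d).
    rewrite Rminus_0_r in *. now rewrite Rabs_Ropp.
  - intros E. apply Ht0. lra. }
rewrite even_generatingE by trivial.
apply is_pseries_R.
eapply is_series_ext;
  [|exact (is_series_scal (V := R_NormedModule) (/ 2) _ _
             (is_series_plus _ _ _ _ Hp Hn))].
intros n. unfold bernoulli_even_part.
change (/ 2 * (B n y * (t ^ n / INR (fact n)) +
               B n y * ((- t) ^ n / INR (fact n))) =
  (1 + (-1) ^ n) / 2 * (B n y / INR (fact n)) * t ^ n).
replace (- t) with ((-1) * t) by ring. rewrite Rpow_mult_distr.
field. apply INR_fact_neq_0.
Qed.

(** The value that Euler's formula assigns to [B_(2j)(y) / (2j)!], found as the
    coefficient of [t^(2j)] in [even_generating y t]. *)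
Definition zeta_coefficient (y : R) (j : nat) : R :=
  match j with
  | O => 1
  | S i => 2 * (-1) ^ i * cos_zeta (S i) (2 * PI * y) / (2 * PI) ^ (2 * S i)
  end.

Lemma is_pseries_zeta_coefficient (y t : R) : 0 <= y <= 1 ->
  0 < Rabs t < 2 * PI ->
  is_pseries (zeta_coefficient y) (t ^ 2) (even_generating y t).
Proof.
intros Hy.
assert (HPI := PI_RGT_0).
assert (Hpos : forall t, 0 < t < 2 * PI ->
  is_pseries (zeta_coefficient y) (t ^ 2) (even_generating y t)).
{ clear t. intros t Ht. set (x := t / (2 * PI)).
  assert (Hx : 0 < x < 1).
  { unfold x. split; [apply Rdiv_lt_0_compat; lra|].
    apply Rlt_div_l; lra. }
  assert (Htx : t = 2 * PI * x) by (unfold x; field; lra).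
  assert (Hs := is_series_cos_series x (2 * PI * y)
                  ltac:(rewrite Rabs_pos_eq; lra)).
  rewrite cos_series_closed_form in Hs by nra.
  apply (is_series_scal (V := R_NormedModule) (2 * x ^ 2)) in Hs.
  apply is_pseries_R.
  apply (is_series_decr_1 (V := R_NormedModule)).
  eapply (is_series_ext (V := R_NormedModule)) in Hs.
  - match type of Hs with is_series _ ?l =>
      replace (plus _ _) with l; [exact Hs|] end.
    assert (0 < sinh (x * PI)) by (apply sinh_pos; nra).
    change (2 * x ^ 2 * (PI / (2 * x) * (cosh (x * (2 * PI * y - PI)) /
        sinh (x * PI)) - / (2 * x ^ 2)) =
      even_generating y t + - (1 * (t ^ 2) ^ 0)).
    unfold even_generating. rewrite Htx.
    replace (2 * PI * x * (y - 1 / 2)) with (x * (2 * PI * y - PI)) by field.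
    replace (2 * PI * x / 2) with (x * PI) by field.
    simpl. field. lra.
  - intros n.
    change (2 * x ^ 2 * ((-1) ^ n * cos_zeta (S n) (2 * PI * y) * (x ^ 2) ^ n) =
      2 * (-1) ^ n * cos_zeta (S n) (2 * PI * y) / (2 * PI) ^ (2 * S n) *
      (t ^ 2) ^ S n).
    rewrite Htx, (Rpow_mult_distr _ x 2), (Rpow_mult_distr _ _ (S n)).
    rewrite <- (pow_mult _ 2 (S n)).
    change ((x ^ 2) ^ S n) with (x ^ 2 * (x ^ 2) ^ n).
    field. apply pow_nonzero; lra. }
intros Ht. destruct (Rcase_abs t) as [H|H].
- rewrite Rabs_left in Ht by lra.
  replace (t ^ 2) with ((- t) ^ 2) by ring.
  replace (even_generating y t) with (even_generating y (- t));
    [now apply Hpos|].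
  unfold even_generating.
  replace (- t * (y - 1 / 2)) with (- (t * (y - 1 / 2))) by ring.
  replace (- t / 2) with (- (t / 2)) by field.
  rewrite cosh_opp, sinh_opp. unfold Rdiv. rewrite Rinv_opp. ring.
- rewrite Rabs_pos_eq in Ht by lra. now apply Hpos.
Qed.

(** Euler's evaluation of [sum cos (2 pi n y) / n^(2 j)] by Bernoulli
    polynomials, read off by comparing two expansions of the same function. *)
Theorem bernoulli_even (B : nat -> R -> R) (y : R) (j : nat) :
  is_bernoulli B -> 0 <= y <= 1 ->
  B (2 * j)%nat y / INR (fact (2 * j)) = zeta_coefficient y j.
Proof.
intros HB Hy.
(* the coefficients in powers of [t] rather than [t^2] *)
set (b := fun n => if Nat.even n then zeta_coefficient y (Nat.div2 n) else 0).
assert (Hb : forall t, 0 < Rabs t < 2 * PI ->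
               is_pseries b t (even_generating y t)).
{ intros t Ht.
  replace (even_generating y t) with (even_generating y t + t * 0) by ring.
  apply is_pseries_odd_even.
  - apply (is_pseries_ext (zeta_coefficient y)).
    + intros n. unfold b. now rewrite Nat.even_even, Nat.div2_even.
    + now apply is_pseries_zeta_coefficient.
  - apply (is_pseries_ext (fun _ => 0)).
    + intros n. unfold b. now rewrite Nat.even_odd.
    + apply is_pseries_R, is_series_of_partial_sums.
      apply (is_lim_seq_ext (fun _ => 0)); [|apply is_lim_seq_const].
      intros N. rewrite (sum_eq _ (fun _ => 0 * 0)).
      * rewrite <- scal_sum. ring.
      * intros; ring. }
assert (E : bernoulli_even_part B y (2 * j) = b (2 * j)%nat).
{ apply pseries_unique_punctured.
  destruct (is_pseries_bernoulli_even_part B y HB) as [d Hd].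
  assert (HP : 0 < 2 * PI) by (generalize PI_RGT_0; lra).
  assert (Hm : 0 < Rmin d (2 * PI))
    by (apply Rmin_glb_lt; [apply cond_pos|lra]).
  exists (mkposreal _ Hm). intros t Ht Ht0.
  change (Rabs (t - 0) < Rmin d (2 * PI)) in Ht.
  assert (H1 := Rmin_l d (2 * PI)). assert (H2 := Rmin_r d (2 * PI)).
  exists (even_generating y t). split.
  - apply Hd; trivial. change (Rabs (t - 0) < d). lra.
  - apply Hb. rewrite Rminus_0_r in Ht. split; [now apply Rabs_pos_lt|lra]. }
unfold bernoulli_even_part, b in E.
rewrite Nat.even_even, Nat.div2_even, pow_1_even in E.
rewrite <- E. field. apply INR_fact_neq_0.
Qed.

(** * The lattice sum *)

Lemma is_lim_seq_finite_sum (w : nat -> nat -> R) (l : nat -> R) (K : nat) :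
  (forall i, is_lim_seq (w i) (l i)) ->
  is_lim_seq (fun N => sum_f_R0 (fun i => w i N) K) (sum_f_R0 l K).
Proof.
intros Hw. induction K as [|K IH]; [apply Hw|].
exact (is_lim_seq_plus' _ _ _ _ IH (Hw (S K))).
Qed.

(** The divisibility of [a^(2k+1) + b^(2k+1)] by [a + b], divided by
    [(a b)^(2k+1)]; it is a finite geometric expansion of [1 / (a + b)] whose
    remainder has been moved to the left. *)
Lemma odd_power_sum_quotient (a b : R) (k : nat) : 0 < a -> 0 < b ->
  / a ^ S (2 * k) * / (a + b) + / b ^ S (2 * k) * / (a + b) =
  sum_f_R0 (fun i => (-1) ^ i * (/ a ^ S i * / b ^ S (2 * k - i))) (2 * k).
Proof.
intros Ha Hb.
assert (E := geometric_remainder a b (2 * k) Ha (Rlt_le _ _ Hb)).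
assert (HA : 0 < a ^ S (2 * k)) by now apply pow_lt.
assert (HB : 0 < b ^ S (2 * k)) by now apply pow_lt.
transitivity (/ b ^ S (2 * k) *
  sum_f_R0 (fun i => (-1) ^ i * b ^ i / a ^ S i) (2 * k)).
- rewrite <- tech_pow_Rmult, pow_1_even in E.
  set (s := sum_f_R0 _ _) in *.
  replace s with (/ (a + b) + b ^ S (2 * k) / a ^ S (2 * k) * / (a + b)) by lra.
  set (A := a ^ S (2 * k)) in *. set (B := b ^ S (2 * k)) in *. field. lra.
- rewrite scal_sum. apply sum_eq. intros i Hi.
  replace (b ^ S (2 * k)) with (b ^ i * b ^ S (2 * k - i))
    by (rewrite <- pow_add; f_equal; lia).
  field. repeat split; apply pow_nonzero; lra.
Qed.

(** Exchanging [m] and [n] leaves the square partial sums unchanged and turns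
    the summand into one whose average with the original is a finite sum of
    products of a function of [m] by a function of [n]. *)
Lemma Series_lattice (k : nat) (t : R) :
  Series (fun m => cos (INR (S m) * t) / INR (S m) ^ (2 * S (2 * k))
                   * cos_series (INR (S m)) t) =
  / 2 * sum_f_R0 (fun i => (-1) ^ i *
          (cos_zeta (S i) t * cos_zeta (S (2 * k - i)) t)) (2 * k).
Proof.
set (c := fun n => cos (INR (S n) * t)).
set (a := fun n => INR (S n) ^ 2).
assert (Ha : forall n, 0 < a n) by (intros n; apply pow_lt, INR_S_pos).
set (g := fun m n => c m / a m ^ S (2 * k) * (c n / (a n + a m))).
set (p := fun i N => sum_f_R0 (fun n => c n / a n ^ S i) N).
assert (Hp : forall i, is_lim_seq (p i) (cos_zeta (S i) t)).
{ intros i.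
  apply (is_lim_seq_ext (sum_f_R0
    (fun n => cos (INR (S n) * t) / INR (S n) ^ (2 * S i)))).
  - intros N. apply sum_eq. intros n _. unfold a, c. now rewrite pow_mult.
  - apply is_lim_seq_partial_sums, ex_series_cos_zeta. }
assert (Hg : is_lim_seq (fun N => sum_f_R0 (fun m => sum_f_R0 (g m) N) N)
               (Series (fun m => Series (g m)))).
{ apply (is_lim_seq_square_sums g inv_sq).
  - intros m n. unfold g. rewrite Rabs_mult.
    apply Rmult_le_compat; try apply Rabs_pos; [|apply cos_term_dominated].
    unfold a. rewrite <- pow_mult. apply cos_zeta_term_dominated.
  - intros n. apply Rlt_le, inv_sq_pos.
  - apply ex_series_inv_sq. }
assert (Hsum : forall N, sum_f_R0 (fun m => sum_f_R0 (g m) N) N =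
  / 2 * sum_f_R0 (fun i => (-1) ^ i * (p i N * p (2 * k - i)%nat N)) (2 * k)).
{ intros N.
  assert (E : 2 * sum_f_R0 (fun m => sum_f_R0 (g m) N) N =
    sum_f_R0 (fun m => sum_f_R0 (fun n => g m n + g n m) N) N).
  { rewrite <- Rplus_diag. rewrite (sum_f_R0_exchange g) at 2.
    rewrite <- plus_sum. apply sum_eq. intros m _. now rewrite plus_sum. }
  assert (E' : sum_f_R0 (fun m => sum_f_R0 (fun n => g m n + g n m) N) N =
    sum_f_R0 (fun i => (-1) ^ i * (p i N * p (2 * k - i)%nat N)) (2 * k)).
  { transitivity (sum_f_R0 (fun m => sum_f_R0 (fun i => sum_f_R0 (fun n =>
      c m / a m ^ S i * (c n / a n ^ S (2 * k - i)) * (-1) ^ i) N)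
      (2 * k)) N).
    - apply sum_eq. intros m _. rewrite <- sum_f_R0_exchange.
      apply sum_eq. intros n _.
      transitivity (c m * c n * (/ a m ^ S (2 * k) * / (a m + a n) +
                                 / a n ^ S (2 * k) * / (a m + a n))).
      + unfold g, Rdiv. rewrite (Rplus_comm (a n) (a m)). ring.
      + rewrite odd_power_sum_quotient, scal_sum by trivial.
        apply sum_eq. intros i _. unfold Rdiv. ring.
    - rewrite sum_f_R0_exchange. apply sum_eq. intros i _.
      unfold p. rewrite <- sum_f_R0_prod, scal_sum. apply sum_eq. intros m _.
      rewrite Rmult_comm, scal_sum. reflexivity. }
  rewrite <- E', <- E. field. }
assert (Hlim : is_lim_seq (fun N => sum_f_R0 (fun m => sum_f_R0 (g m) N) N)
  (/ 2 * sum_f_R0 (fun i => (-1) ^ i *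
          (cos_zeta (S i) t * cos_zeta (S (2 * k - i)) t)) (2 * k))).
{ eapply is_lim_seq_ext; [intros N; symmetry; apply Hsum|].
  apply (is_lim_seq_scal_l _ (/ 2) (Finite _)).
  apply (is_lim_seq_finite_sum
           (fun i N => (-1) ^ i * (p i N * p (2 * k - i)%nat N))).
  intros i. apply (is_lim_seq_scal_l _ ((-1) ^ i) (Finite _)).
  apply is_lim_seq_mult'; apply Hp. }
rewrite <- (is_lim_seq_unique_finite _ _ _ Hg Hlim).
apply Series_ext. intros m. unfold g. rewrite Series_scal_l.
unfold a at 1. rewrite <- pow_mult. reflexivity.
Qed.

(** * Summation over the nonzero integers *)

Definition hyperbolic_term (k : nat) (t : R) (n : nat) : R :=
  cos (INR (S n) * t) / INR (S n) ^ (4 * k + 3)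
  * (cosh (INR (S n) * (t - PI)) / sinh (INR (S n) * PI)).

Lemma hyperbolic_termE (k : nat) (t : R) (n : nat) : 0 <= t <= 2 * PI ->
  hyperbolic_term k t n =
  2 / PI * (cos (INR (S n) * t) / INR (S n) ^ (2 * S (2 * k))
            * cos_series (INR (S n)) t)
  + / PI * (cos (INR (S n) * t) / INR (S n) ^ (2 * S (2 * k + 1))).
Proof.
intros Ht. rewrite cos_series_closed_form by (trivial; apply INR_S_pos).
unfold hyperbolic_term.
replace (4 * k + 3)%nat with (2 * S (2 * k) + 1)%nat by lia.
replace (2 * S (2 * k + 1))%nat with (2 * S (2 * k) + 2)%nat by lia.
assert (Hr := INR_S_pos n). assert (HPI := PI_RGT_0).
assert (Hs : 0 < sinh (INR (S n) * PI)) by (apply sinh_pos; nra).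
rewrite !pow_add. set (r := INR (S n)) in *.
assert (Hp : r ^ (2 * S (2 * k)) <> 0) by (apply pow_nonzero; lra).
set (q := r ^ (2 * S (2 * k))) in *. simpl. field. repeat split; lra.
Qed.

Lemma hyperbolic_term_bound (k : nat) (t : R) : 0 <= t <= 2 * PI ->
  exists C, forall n, Rabs (hyperbolic_term k t n) <= C * inv_sq n.
Proof.
intros Ht. assert (HPI := PI_RGT_0).
exists (2 / PI * Series inv_sq + / PI). intros n.
rewrite hyperbolic_termE by trivial.
eapply Rle_trans; [apply Rabs_triang|].
assert (H1 := cos_zeta_term_dominated (2 * k) n t).
assert (H2 := cos_zeta_term_dominated (2 * k + 1) n t).
assert (H3 : Rabs (cos_series (INR (S n)) t) <= Series inv_sq).
{ apply Series_dominated; [|apply ex_series_inv_sq].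
  intros m. apply cos_term_dominated. }
rewrite !Rabs_mult.
assert (Hi : 0 < / PI) by now apply Rinv_0_lt_compat.
assert (Hi' : 0 < 2 / PI) by (unfold Rdiv; lra).
rewrite (Rabs_pos_eq (2 / PI)), (Rabs_pos_eq (/ PI)) by lra.
rewrite Rmult_plus_distr_r. apply Rplus_le_compat.
- rewrite Rmult_assoc. apply Rmult_le_compat_l; [lra|].
  rewrite Rmult_comm. apply Rmult_le_compat; trivial; apply Rabs_pos.
- apply Rmult_le_compat_l; [lra|exact H2].
Qed.

Lemma Series_hyperbolic_term (k : nat) (t : R) : 0 <= t <= 2 * PI ->
  Series (hyperbolic_term k t) =
  / PI * (sum_f_R0 (fun i => (-1) ^ i *
            (cos_zeta (S i) t * cos_zeta (S (2 * k - i)) t)) (2 * k)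
          + cos_zeta (S (2 * k + 1)) t).
Proof.
intros Ht.
rewrite (Series_ext _ _ (fun n => hyperbolic_termE k t n Ht)).
rewrite Series_plus, !Series_scal_l, Series_lattice.
- change (Series (fun n => _ / _)) with (cos_zeta (S (2 * k + 1)) t).
  field. apply PI_neq0.
- apply (ex_series_scal (V := R_NormedModule)).
  apply (ex_series_dominated _ (fun n => inv_sq n * Series inv_sq));
    [|apply ex_series_scal_r, ex_series_inv_sq].
  intros n. rewrite Rabs_mult.
  apply Rmult_le_compat; try apply Rabs_pos;
    [apply cos_zeta_term_dominated|].
  apply Series_dominated; [|apply ex_series_inv_sq].
  intros m. apply cos_term_dominated.
- apply (ex_series_scal (V := R_NormedModule)). apply ex_series_cos_zeta.
Qed.

(** The term of index [j = i + 1] matches the product of index [i] in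
    [Series_lattice]; the terms [j = 0] and [j = 2k + 2] are equal and contain
    the factor [B_0 = 1]. *)
Lemma bernoulli_sumE (B : nat -> R -> R) (k : nat) (y : R) :
  is_bernoulli B -> 0 <= y <= 1 ->
  (2 * PI) ^ (4 * k + 3) *
  sum_f_R0 (fun j : nat => (-1) ^ (j + 1) *
     (B (2 * j)%nat y / INR (fact (2 * j))) *
     (B (4 * k + 4 - 2 * j)%nat y / INR (fact (4 * k + 4 - 2 * j))))
     (2 * k + 2) = 2 * Series (hyperbolic_term k (2 * PI * y)).
Proof.
intros HB Hy. assert (HPI := PI_RGT_0).
rewrite Series_hyperbolic_term by nra.
set (P := 2 * PI). assert (HP : 0 < P) by (unfold P; lra).
set (t := P * y).
rewrite (sum_eq _ (fun j => (-1) ^ (j + 1) * zeta_coefficient y j *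
                            zeta_coefficient y (2 * k + 2 - j))).
2:{ intros j Hj. rewrite bernoulli_even by trivial.
    replace (4 * k + 4 - 2 * j)%nat with (2 * (2 * k + 2 - j))%nat by lia.
    now rewrite bernoulli_even by trivial. }
replace (2 * k + 2)%nat with (S (S (2 * k))) by lia.
rewrite decomp_sum by lia. rewrite Nat.pred_succ, tech5.
rewrite Nat.sub_0_r, Nat.sub_diag.
rewrite (sum_eq _ (fun i =>
  (-1) ^ i * (cos_zeta (S i) t * cos_zeta (S (2 * k - i)) t) *
                            (4 / P ^ (4 * k + 4)))).
2:{ intros i Hi.
    replace (S (S (2 * k)) - S i)%nat with (S (2 * k - i)) by lia.
    unfold zeta_coefficient. fold P t.
    replace (S i + 1)%nat with (i + 2)%nat by lia.
    replace (4 * k + 4)%nat with (2 * S i + 2 * S (2 * k - i))%nat by lia.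
    rewrite !(pow_add P).
    assert (Hsgn : (-1) ^ (2 * k - i) = (-1) ^ i).
    { rewrite <- (Rmult_1_l ((-1) ^ (2 * k - i))), <- (pow_1_even i).
      replace (2 * i)%nat with (i + i)%nat by lia.
      rewrite pow_add, Rmult_assoc, <- pow_add.
      replace (i + (2 * k - i))%nat with (2 * k)%nat by lia.
      rewrite pow_1_even. ring. }
    rewrite Hsgn, pow_add.
    assert (Hq : (-1) ^ i * (-1) ^ i = 1).
    { rewrite <- pow_add. replace (i + i)%nat with (2 * i)%nat by lia.
      apply pow_1_even. }
    set (s := (-1) ^ i) in *.
    replace (s * (-1) ^ 2 * (2 * s * cos_zeta (S i) t / P ^ (2 * S i)) *
       (2 * s * cos_zeta (S (2 * k - i)) t / P ^ (2 * S (2 * k - i))))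
      with (s * (s * s) * (cos_zeta (S i) t * cos_zeta (S (2 * k - i)) t) *
       (4 * (/ P ^ (2 * S i) * / P ^ (2 * S (2 * k - i)))))
      by (unfold Rdiv; ring).
    rewrite Hq. unfold Rdiv. rewrite Rinv_mult. ring. }
rewrite <- scal_sum.
set (sigma := sum_f_R0 _ _).
unfold zeta_coefficient. fold P t.
replace (S (2 * k + 1)) with (S (S (2 * k))) by lia.
replace (S (S (2 * k)) + 1)%nat with (2 * k + 3)%nat by lia.
replace (4 * k + 3)%nat with (2 * (2 * k + 1) + 1)%nat by lia.
replace (4 * k + 4)%nat with (2 * (2 * k + 1) + 2)%nat by lia.
replace (2 * S (S (2 * k)))%nat with (2 * (2 * k + 1) + 2)%nat by lia.
change ((-1) ^ S (2 * k)) with (-1 * (-1) ^ (2 * k)).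
rewrite !pow_add, pow_1_even.
assert (Hq : P ^ (2 * (2 * k + 1)) <> 0) by (apply pow_nonzero; lra).
set (q := P ^ (2 * (2 * k + 1))) in *. set (z := cos_zeta (S (S (2 * k))) t).
replace PI with (P / 2) by (unfold P; field).
simpl. field. split; [lra|exact Hq].
Qed.

Lemma is_sum_nonzero_Z_even (f : Z -> R) (g : nat -> R) (C : R) :
  (forall n, f (Z.of_nat (S n)) = g n) ->
  (forall n, f (- Z.of_nat (S n))%Z = g n) ->
  (forall n, Rabs (g n) <= C * inv_sq n) ->
  is_sum_nonzero_Z f (2 * Series g).
Proof.
intros Hp Hn HC.
assert (Hg : ex_series (fun n => Rabs (g n))).
{ apply (ex_series_dominated _ (fun n => C * inv_sq n)).
  - intros n. now rewrite Rabs_Rabsolu.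
  - apply (ex_series_scal (V := R_NormedModule)), ex_series_inv_sq. }
split; [|split].
- apply (ex_series_ext (fun n => Rabs (g n))); trivial.
  intros n. f_equal. symmetry. apply Hp.
- apply (ex_series_ext (fun n => Rabs (g n))); trivial.
  intros n. f_equal. symmetry. apply Hn.
- rewrite (Series_ext _ g Hp), (Series_ext _ g Hn). ring.
Qed.

Lemma is_sum_nonzero_Z_ext (f g : Z -> R) (l : R) :
  (forall m, f m = g m) -> is_sum_nonzero_Z f l -> is_sum_nonzero_Z g l.
Proof.
intros Hfg (H1 & H2 & H3). split; [|split].
- eapply ex_series_ext; [|exact H1]. intros n. simpl. apply f_equal, Hfg.
- eapply ex_series_ext; [|exact H2]. intros n. simpl. apply f_equal, Hfg.
- rewrite H3. f_equal; apply Series_ext; intros n; apply Hfg.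
Qed.

Lemma pow_opp_odd (r : R) (k : nat) : (- r) ^ (4 * k + 3) = - r ^ (4 * k + 3).
Proof.
replace (4 * k + 3)%nat with (S (2 * (2 * k + 1))) by lia.
rewrite <- !tech_pow_Rmult, !pow_mult.
replace ((- r) ^ 2) with (r ^ 2) by ring. ring.
Qed.

Lemma cos_IZR_PI (m : Z) : cos (IZR m * PI) = powerRZ (-1) m.
Proof.
assert (Hn : forall n, cos (INR n * PI) = (-1) ^ n).
{ induction n as [|n IH]; [simpl; now rewrite Rmult_0_l, cos_0|].
  rewrite S_INR, Rmult_plus_distr_r, Rmult_1_l, neg_cos, IH. simpl. ring. }
destruct m as [|p|p].
- simpl. now rewrite Rmult_0_l, cos_0.
- rewrite <- positive_nat_Z, <- INR_IZR_INZ, <- pow_powerRZ. apply Hn.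
- change (powerRZ (-1) (Z.neg p)) with (/ (-1) ^ Pos.to_nat p).
  rewrite <- (Pos2Z.opp_pos p), opp_IZR, Ropp_mult_distr_l_reverse, cos_neg.
  rewrite <- positive_nat_Z, <- INR_IZR_INZ, Hn.
  rewrite <- pow_inv. f_equal. lra.
Qed.

Theorem corollary6p3 (B : nat -> R -> R) (hB : is_bernoulli B) :
  (forall (k : nat) (y : R), 0 <= y <= 1 ->
    is_sum_nonzero_Z
      (fun m : Z => cos (2 * IZR m * PI * y) / IZR m ^ (4 * k + 3) *
                    (cosh (2 * IZR m * PI * (y - 1 / 2)) / sinh (IZR m * PI)))
      ((2 * PI) ^ (4 * k + 3) *
       sum_f_R0 (fun j : nat => (-1) ^ (j + 1) *
         (B (2 * j)%nat y / INR (fact (2 * j))) *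
         (B (4 * k + 4 - 2 * j)%nat y / INR (fact (4 * k + 4 - 2 * j))))
         (2 * k + 2))) /\
  (forall k : nat,
    is_sum_nonzero_Z
      (fun m : Z => coth (IZR m * PI) / IZR m ^ (4 * k + 3))
      ((2 * PI) ^ (4 * k + 3) *
       sum_f_R0 (fun j : nat => (-1) ^ (j + 1) *
         (B (2 * j)%nat 0 / INR (fact (2 * j))) *
         (B (4 * k + 4 - 2 * j)%nat 0 / INR (fact (4 * k + 4 - 2 * j))))
         (2 * k + 2))) /\
  (forall k : nat,
    is_sum_nonzero_Z
      (fun m : Z => powerRZ (-1) m / (sinh (IZR m * PI) * IZR m ^ (4 * k + 3)))
      ((2 * PI) ^ (4 * k + 3) *
       sum_f_R0 (fun j : nat => (-1) ^ (j + 1) *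
         (B (2 * j)%nat (1 / 2) / INR (fact (2 * j))) *
         (B (4 * k + 4 - 2 * j)%nat (1 / 2) / INR (fact (4 * k + 4 - 2 * j))))
         (2 * k + 2))).
Proof.
assert (Hmain : forall (k : nat) (y : R), 0 <= y <= 1 ->
    is_sum_nonzero_Z
      (fun m : Z => cos (2 * IZR m * PI * y) / IZR m ^ (4 * k + 3) *
                    (cosh (2 * IZR m * PI * (y - 1 / 2)) / sinh (IZR m * PI)))
      ((2 * PI) ^ (4 * k + 3) *
       sum_f_R0 (fun j : nat => (-1) ^ (j + 1) *
         (B (2 * j)%nat y / INR (fact (2 * j))) *
         (B (4 * k + 4 - 2 * j)%nat y / INR (fact (4 * k + 4 - 2 * j))))
         (2 * k + 2))).
{ intros k y Hy. assert (HPI := PI_RGT_0).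
  rewrite bernoulli_sumE by trivial.
  destruct (hyperbolic_term_bound k (2 * PI * y)) as [C HC]; [nra|].
  assert (Hpos : forall r n, r = INR (S n) ->
    cos (2 * r * PI * y) / r ^ (4 * k + 3) *
      (cosh (2 * r * PI * (y - 1 / 2)) / sinh (r * PI)) =
    hyperbolic_term k (2 * PI * y) n).
  { intros r n ->. unfold hyperbolic_term.
    replace (2 * INR (S n) * PI * y) with (INR (S n) * (2 * PI * y)) by ring.
    now replace (2 * INR (S n) * PI * (y - 1 / 2))
      with (INR (S n) * (2 * PI * y - PI)) by field. }
  apply (is_sum_nonzero_Z_even _ _ C); trivial.
  - intros n. apply Hpos. now rewrite INR_IZR_INZ.
  - intros n. rewrite <- (Hpos _ n eq_refl), opp_IZR, <- INR_IZR_INZ.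
    rewrite pow_opp_odd. set (r := INR (S n)).
    replace (2 * - r * PI * y) with (- (2 * r * PI * y)) by ring.
    replace (2 * - r * PI * (y - 1 / 2))
      with (- (2 * r * PI * (y - 1 / 2))) by ring.
    replace (- r * PI) with (- (r * PI)) by ring.
    rewrite cos_neg, cosh_opp, sinh_opp. unfold Rdiv. rewrite !Rinv_opp. ring. }
split; [exact Hmain|split]; intros k.
- eapply is_sum_nonzero_Z_ext; [|apply Hmain; lra]. intros m. simpl.
  rewrite Rmult_0_r, cos_0.
  replace (2 * IZR m * PI * (0 - 1 / 2)) with (- (IZR m * PI)) by field.
  rewrite cosh_opp. unfold coth, Rdiv. ring.
- eapply is_sum_nonzero_Z_ext; [|apply Hmain; lra]. intros m. simpl.
  replace (2 * IZR m * PI * (1 / 2)) with (IZR m * PI) by field.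
  rewrite cos_IZR_PI, Rminus_diag, Rmult_0_r, cosh_0.
  unfold Rdiv. rewrite Rinv_mult. ring.
Qed.
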